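(* Let $M$ be an even positive integer, $h_0,\dots,h_{M-1}$ the filter coefficients of a wavelet of order $M$, and let $n,d$ be positive integers with $d\le n$ (and $2^{n-d+1}\ge M$). Then the $d$-level packet quantum wavelet transform $P^{(d)}_n$ on $n$ qubits can be implemented exactly using $\lceil\log_2M\rceil+1$ ancilla qubits and $\mathcal{O}(dn-d^2/2)+\mathcal{O}(dM^{3/2})$ Toffoli gates and elementary one- and two-qubit gates. *)

(* Defs.v *)
From HB Require Import structures.
From mathcomp Require Import all_boot all_order all_algebra.
From mathcomp Require Import complex.
From mathcomp Require Import reals.

Set Implicit Arguments.
Unset Strict Implicit.
Unset Printing Implicit Defensive.

Import Order.TTheory GRing.Theory Num.Theory.
Local Open Scope ring_scope.

Section Defs.
Variable R : realType.
Local Notation C := (R[i]).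

Definition mxnat m n (A : 'M[C]_(m, n)) (i j : nat) : C :=
  match @insub nat (fun k => k < m)%N _ i, @insub nat (fun k => k < n)%N _ j with
  | Some i', Some j' => A i' j'
  | _, _ => 0
  end.

Definition adjmx m n (A : 'M[C]_(m, n)) : 'M[C]_(n, m) := (map_mx Num.conj A)^T.
Definition unitary_mx n (U : 'M[C]_n) : Prop := U *m adjmx U = 1%:M.

(** Computational basis of k qubits: index x < 2^k; qubit q carries bit q of x. *)
Definition bit (q x : nat) : bool := odd (x %/ 2 ^ q).

Definition local_idx (qs : seq nat) (x : nat) : nat :=
  \sum_(j < size qs) (bit (nth 0%N qs j) x) * 2 ^ j.

(** The k-qubit operator acting as the 2^(size qs)-dimensional operator f on
    the qubits qs and as the identity on all other qubits. *)
Definition embed (k : nat) (qs : seq nat) (f : nat -> nat -> C) : 'M[C]_(2 ^ k) :=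
  \matrix_(x < 2 ^ k, y < 2 ^ k)
    (if [forall q : 'I_k, (val q \notin qs) ==> (bit q x == bit q y)]
     then f (local_idx qs x) (local_idx qs y) else 0).

(** Toffoli gate on 3 qubits (local bits: 0,1 = controls, 2 = target). *)
Definition toffoli_perm (j : nat) : nat :=
  if j == 3%N then 7%N else if j == 7%N then 3%N else j.
Definition toffoli_mx : 'M[C]_8 :=
  \matrix_(i < 8, j < 8) ((val i == toffoli_perm j)%:R).

Definition is_gate (k : nat) (G : 'M[C]_(2 ^ k)) : Prop :=
  (exists (q : nat) (U : 'M[C]_2),
      (q < k)%N /\ unitary_mx U /\ G = embed k [:: q] (mxnat U))
  \/ (exists (q1 q2 : nat) (U : 'M[C]_4),
      (q1 < k)%N /\ (q2 < k)%N /\ q1 != q2 /\ unitary_mx U /\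
      G = embed k [:: q1; q2] (mxnat U))
  \/ (exists c1 c2 t : nat,
      (c1 < k)%N /\ (c2 < k)%N /\ (t < k)%N /\ uniq [:: c1; c2; t] /\
      G = embed k [:: c1; c2; t] (mxnat toffoli_mx)).

Definition circuit_mx (k : nat) (c : seq 'M[C]_(2 ^ k)) : 'M[C]_(2 ^ k) :=
  foldl (fun acc g => g *m acc) 1%:M c.

Definition all_gates (k : nat) (c : seq 'M[C]_(2 ^ k)) : Prop :=
  forall g, g \in c -> is_gate g.

(** A circuit on n + a qubits (the a ancilla qubits are the low-order qubits)
    implements the n-qubit operator P exactly with clean ancillas:
    |x>|0^a>  |->  (P|x>) |0^a>  for every basis state x. *)
Definition implements_with_ancillas (n a : nat) (c : seq 'M[C]_(2 ^ (n + a)))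
  (P : 'M[C]_(2 ^ n)) : Prop :=
  forall (x y : nat) (z : nat), (x < 2 ^ n)%N -> (y < 2 ^ n)%N -> (z < 2 ^ a)%N ->
    mxnat (circuit_mx c) (y * 2 ^ a + z) (x * 2 ^ a)
    = (if z == 0%N then mxnat P y x else 0).

(** Filter coefficients h_0..h_{M-1} of a (compactly supported, orthonormal)
    wavelet of order M: real numbers with sum sqrt 2 and
    sum_k h_k h_{k+2m} = delta_{m,0}.  h is extended by 0 outside [0,M). *)
Definition wavelet_filter (M : nat) (h : nat -> R) : Prop :=
  (forall k, (M <= k)%N -> h k = 0) /\
  \sum_(k < M) h k = Num.sqrt 2 /\
  (forall m : nat, \sum_(k < M) h k * h (k + 2 * m)%N = (m == 0%N)%:R).

Definition hipass (M : nat) (h : nat -> R) (k : nat) : R :=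
  if (k < M)%N then (-1) ^+ k * h (M.-1 - k)%N else 0.

(** Wavelet kernel (after the perfect shuffle) on N = 2^m points, periodic
    boundary: rows i < N/2 carry h shifted by 2i, rows N/2 + i carry g
    shifted by 2i (indices mod N). *)
Definition wkernel (M N : nat) (h : nat -> R) (i j : nat) : C :=
  let half := N./2 in
  if (i < half)%N then ((h ((j + N - 2 * i) %% N)%N)%:C)%C
  else ((hipass M h ((j + N - 2 * (i - half)) %% N)%N)%:C)%C.

(** level l (l = 0 .. d-1) of the packet transform: I_{2^l} (x) W_{2^(n-l)} *)
Definition packet_level (M n : nat) (h : nat -> R) (l : nat) : 'M[C]_(2 ^ n) :=
  let Nl := (2 ^ (n - l))%N in
  \matrix_(x < 2 ^ n, y < 2 ^ n)
    (if (x %/ Nl == y %/ Nl)%N then wkernel M Nl h (x %% Nl)%N (y %% Nl)%N else 0).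

Definition packet_qwt (M n d : nat) (h : nat -> R) : 'M[C]_(2 ^ n) :=
  foldl (fun acc l => packet_level M n h l *m acc) 1%:M (iota 0 d).

End Defs.
Arguments implements_with_ancillas {R} n a c P.
Arguments all_gates {R} k c.

(* Main.v *)
Require Import Defs.
From HB Require Import structures.
From mathcomp Require Import all_boot all_order all_algebra.
From mathcomp Require Import complex.
From mathcomp Require Import reals boolp.
From mathcomp Require Import zify ring lra.

Set Implicit Arguments.
Unset Strict Implicit.
Unset Printing Implicit Defensive.

Import Order.TTheory GRing.Theory Num.Theory.

(** The polyphase matrix of an orthonormal filter bank of length 2(L+1) factors
    into L+1 plane rotations of the parity qubit, separated by L unit delays, a
    delay being an increment of the remaining qubits controlled by the parity
    qubit.  Performing every delay on the whole register would be too expensive.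
    Instead, the lattice F is run on w = up_log 2 M - 1 low-order qubits extended
    by two ancillas, modulo 4W with W = 2^w > L.  On a state starting in block 0
    the extension then shows block 3 = -1 exactly on the part that carries into
    the high-order qubits, and 0 elsewhere.  One controlled increment of the high
    part moves that component, F is undone, and the lattice is run again on the
    w low-order qubits alone.  The two components of F psi pull back under F to
    block 0: a priori to blocks {0,1} and {3,0}, and their sum lies in block 0.
    Short increments ripple through clean ancillas; the long one uses in-place
    adders borrowing the other half of the register, hence has linear size. *)

(** * Bit configurations and gates *)

(** Carrying out all M/2 - 1 delays of a level on m qubits would cost O(mM). One long increment per
    level costs only O(m), and the short lattices cost O(M log M), which is within O(M^(3/2)).
    Summing m = n - l over the levels l < d produces dn - d^2/2. The difficulty is that the carry
    must leave no trace: after the long increment the block bits are still correlated with the data.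
    Undoing F disentangles them because F commutes with the change of the high part, and the rerun
    modulo W then wraps precisely where the high part has already been corrected. Operators act on
    functions of bit configurations, classical gates by precomposition. Hence an increment of
    configurations lowers the support of a state: overflow appears in block -1, and undoing F raises
    the support. All gates are self-inverse, so reversing a list inverts a circuit. For M > 2 the
    ancillas are two block bits, one zero carry input and w - 1 carries of the short increments, w +
    2 in all. *)

Definition upd (s : nat -> bool) (q : nat) (b : bool) : nat -> bool :=
  fun r => if r == q then b else s r.

Lemma upd_eq s q b : upd s q b q = b.
Proof. by rewrite /upd eqxx. Qed.

Lemma upd_neq s q b r : r != q -> upd s q b r = s r.
Proof. by rewrite /upd => /negbTE->. Qed.

Lemma upd_id s q : upd s q (s q) = s.
Proof. by apply/funext => r; rewrite /upd; case: eqP => // ->. Qed.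

Lemma upd_upd s q b b' : upd (upd s q b) q b' = upd s q b'.
Proof. by apply/funext => r; rewrite /upd; case: eqP. Qed.

Lemma updC s q r b b' : q != r -> upd (upd s q b) r b' = upd (upd s r b') q b.
Proof.
move=> nqr; apply/funext => t; rewrite /upd.
by case: (t =P r) => [->|//]; rewrite eq_sym (negbTE nqr).
Qed.

Lemma all_upd s q b qs : q \notin qs -> all (upd s q b) qs = all s qs.
Proof.
move=> nq; apply: eq_in_all => r rqs; apply: upd_neq.
by apply: contraNneq nq => <-.
Qed.

(** Lists of positions are little-endian, and the carry out of the last position is dropped, so this
    is addition of 1 modulo [2 ^ size qs]. *)
Fixpoint inc (qs : seq nat) (s : nat -> bool) : nat -> bool :=
  if qs is q :: qs' then
    if s q then inc qs' (upd s q false) else upd s q true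
  else s.

Fixpoint numval (qs : seq nat) (s : nat -> bool) : nat :=
  if qs is q :: qs' then s q + (numval qs' s).*2 else 0.

Lemma inc_out qs s q : q \notin qs -> inc qs s q = s q.
Proof.
elim: qs s => //= r qs IH s; rewrite inE negb_or => /andP[nqr nq].
by case: ifP => _; rewrite ?IH // upd_neq.
Qed.

Lemma inc_upd qs s q b : q \notin qs -> inc qs (upd s q b) = upd (inc qs s) q b.
Proof.
elim: qs s => //= r qs IH s; rewrite inE negb_or => /andP[nqr nq].
rewrite upd_neq 1?eq_sym //; case: ifP => _; last by rewrite updC.
by rewrite updC // IH.
Qed.

Lemma inc_cat A B s : uniq A ->
  inc (A ++ B) s = if all s A then inc B (inc A s) else inc A s.
Proof.
elim: A s => //= q A IH s /andP[nq uA]; case: (s q) => //=.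
by rewrite IH // all_upd.
Qed.

Lemma numval_lt qs s : numval qs s < 2 ^ size qs.
Proof. by elim: qs => //= q qs IH; rewrite expnS; case: (s q) => /=; lia. Qed.

Lemma numval_upd qs s q b : q \notin qs -> numval qs (upd s q b) = numval qs s.
Proof.
elim: qs => //= r qs IH; rewrite inE negb_or => /andP[nqr nq].
by rewrite IH // upd_neq // eq_sym.
Qed.

Lemma eq_numval qs s t : {in qs, s =1 t} -> numval qs s = numval qs t.
Proof.
elim: qs => //= q qs IH st; rewrite st ?mem_head // IH // => r rqs.
by apply: st; rewrite inE rqs orbT.
Qed.

Lemma numval_cat A B s :
  numval (A ++ B) s = numval A s + 2 ^ size A * numval B s.
Proof. by elim: A => [|q A IH] /=; rewrite ?mul1n // IH expnS; lia. Qed.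

Lemma numval_inc qs s : uniq qs ->
  numval qs (inc qs s) =
  if (numval qs s).+1 == 2 ^ size qs then 0 else (numval qs s).+1.
Proof.
elim: qs s => //= q qs IH s /andP[nq uq]; have lt := numval_lt qs s.
have pos : 0 < 2 ^ size qs by rewrite expn_gt0.
rewrite expnS; case sq: (s q); last first.
  by rewrite upd_eq numval_upd //=; case: eqP => //; lia.
rewrite IH // numval_upd // inc_out // upd_eq /=.
by case: eqP => e1; case: eqP => e2; lia.
Qed.

Lemma all_numval qs s : all s qs = ((numval qs s).+1 == 2 ^ size qs).
Proof.
elim: qs => //= q qs ->; rewrite expnS.
have lt := numval_lt qs s; have pos : 0 < 2 ^ size qs by rewrite expn_gt0.
by case: (s q) => /=; lia.
Qed.

(* [f] neither reads nor writes the positions in [qs]. *)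
Definition away (qs : seq nat) (f : (nat -> bool) -> nat -> bool) : Prop :=
  (forall s q b, q \in qs -> f (upd s q b) = upd (f s) q b) /\
  (forall s q, q \in qs -> f s q = s q).

Lemma away_inc qs rs : ~~ has (mem rs) qs -> away qs (inc rs).
Proof.
move=> /hasPn dis; split=> [s q b|s q] /dis; last exact: inc_out.
exact: inc_upd.
Qed.

Lemma away_sub qs rs f : {subset rs <= qs} -> away qs f -> away rs f.
Proof. by move=> sub [f1 f2]; split=> [s q b|s q] /sub; [exact: f1|exact: f2]. Qed.

Lemma away_comm qs f s : away qs f -> inc qs (f s) = f (inc qs s).
Proof.
elim: qs s => //= q qs IH s awf.
have awf' : away qs f by apply: away_sub awf => r; rewrite inE orbC => ->.
case: awf => f1 f2; rewrite f2 ?mem_head //; case: ifP => _.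
  by rewrite -f1 ?mem_head // IH.
by rewrite f1 // mem_head.
Qed.

(** Specification of in-place addition: the first components receive the sum, the second ones are
    kept. The conditional is the majority of [s v], [s g] and [b], that is, the carry handed on. *)
Fixpoint addf (b : bool) (vg : seq (nat * nat)) (s : nat -> bool) : nat -> bool :=
  if vg is (v, g) :: vg' then
    upd (addf (if s v == s g then s v else b) vg' s) v (b (+) s v (+) s g)
  else s.

Lemma addf_out b vg s q : q \notin unzip1 vg -> addf b vg s q = s q.
Proof.
elim: vg b s => //= -[v g] vg IH b s /=; rewrite inE negb_or => /andP[nqv nq].
by rewrite upd_neq // IH.
Qed.

Lemma addf_upd b vg s q x : q \notin unzip1 vg -> q \notin unzip2 vg ->
  addf b vg (upd s q x) = upd (addf b vg s) q x.
Proof.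
elim: vg b s => //= -[v g] vg IH b s /=; rewrite !inE !negb_or.
move=> /andP[nqv n1] /andP[nqg n2].
by rewrite !upd_neq 1?eq_sym // IH // updC.
Qed.

(** An incoming carry may be spent on the first summand beforehand. This is what turns an addition
    followed by a subtraction into a conditional increment. *)
Lemma addf_carry vg s : uniq (unzip1 vg) -> ~~ has (mem (unzip1 vg)) (unzip2 vg) ->
  addf true vg s = addf false vg (inc (unzip1 vg) s).
Proof.
elim: vg s => //= -[v g] vg IH s /= /andP[nv uv].
rewrite negb_or inE negb_or => /andP[/andP[ngv ng] dis].
have nv2 : v \notin unzip2 vg.
  by apply/negP => v2; move/hasPn: dis => /(_ _ v2) /=; rewrite inE eqxx.
have dis' : ~~ has (mem (unzip1 vg)) (unzip2 vg).
  apply/hasPn => x /(hasPn dis); apply: contraNN; rewrite /= inE => ->.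
  by rewrite orbT.
case sv: (s v) => /=.
  rewrite !inc_upd // upd_eq (upd_neq _ _ ngv) inc_out //= addf_upd // upd_upd.
  by case: (s g); rewrite /= IH.
rewrite upd_eq upd_neq //= addf_upd // upd_upd.
by case: (s g).
Qed.

(** * Gates acting on amplitudes, and increments from in-place adders *)

Section Circuits.
Variable R : realType.
Local Notation C := (R[i]).

(** [Refl q x y] stands for the matrix [[x, y], [y, -x]]. Reflections rather than rotations are
    primitive because then every gate is an involution. *)
Inductive gate : Type :=
  | Cnot of nat & nat
  | Tof of nat & nat & nat
  | Refl of nat & R & R.

Definition qubits (g : gate) : seq nat :=
  match g with
  | Cnot c t => [:: c; t]
  | Tof c1 c2 t => [:: c1; c2; t]
  | Refl q _ _ => [:: q]
  end.

Definition gate_ok (P : pred nat) (g : gate) : bool :=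
  [&& uniq (qubits g), all P (qubits g) &
   if g is Refl _ x y then (x ^+ 2 + y ^+ 2 == 1)%R else true].

Definition classical (g : gate) : bool := if g is Refl _ _ _ then false else true.

Definition act (g : gate) (s : nat -> bool) : nat -> bool :=
  match g with
  | Cnot c t => upd s t (s t (+) s c)
  | Tof c1 c2 t => upd s t (s t (+) (s c1 && s c2))
  | Refl _ _ _ => s
  end.

(* Amplitudes transform by precomposition, so the gates of a circuit are applied
   to a configuration from right to left. *)
Definition pull (c : seq gate) (s : nat -> bool) : nat -> bool := foldr act s c.

Local Open Scope ring_scope.

Definition refl (q : nat) (x y : C) (psi : (nat -> bool) -> C) (s : nat -> bool) : C :=
  if s q then y * psi (upd s q false) - x * psi (upd s q true)
  else x * psi (upd s q false) + y * psi (upd s q true).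

Definition sem (g : gate) (psi : (nat -> bool) -> C) : (nat -> bool) -> C :=
  match g with
  | Refl q x y => refl q (x%:C)%C (y%:C)%C psi
  | _ => psi \o act g
  end.

Definition sems (c : seq gate) (psi : (nat -> bool) -> C) : (nat -> bool) -> C :=
  foldl (fun phi g => sem g phi) psi c.

Lemma sems_cat c1 c2 psi : sems (c1 ++ c2) psi = sems c2 (sems c1 psi).
Proof. by rewrite /sems foldl_cat. Qed.

Lemma pull_cat c1 c2 s : pull (c1 ++ c2) s = pull c1 (pull c2 s).
Proof. by rewrite /pull foldr_cat. Qed.

Lemma sems_classical c psi : all classical c -> sems c psi = psi \o pull c.
Proof.
elim: c psi => //= g c IH psi /andP[cg cc].
by rewrite IH //; case: g cg.
Qed.

Lemma act_involutive P g s : gate_ok P g -> act g (act g s) = s.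
Proof.
case: g => [c t|c1 c2 t|//] /and3P[]; rewrite /= !inE ?negb_or.
  move=> /andP[nct _] _ _.
  by rewrite upd_upd upd_eq upd_neq // -addbA addbb addbF upd_id.
move=> /and3P[/andP[_ n1] n2 _] _ _.
by rewrite upd_upd upd_eq !upd_neq // -addbA addbb addbF upd_id.
Qed.

Lemma sem_involutive P g psi : gate_ok P g -> sem g (sem g psi) = psi.
Proof.
move=> ok; apply/funext => s.
case: g ok => [c t|c1 c2 t|q x y] ok; rewrite /= ?[act _ (act _ _)](act_involutive _ ok).
- by congr psi; apply: (act_involutive _ ok).
- by congr psi; apply: (act_involutive _ ok).
case/and3P: ok => _ _ /eqP xy.
have {}xy : (x%:C)%C ^+ 2 + (y%:C)%C ^+ 2 = 1 :> C.
  by rewrite -!rmorphXn -rmorphD xy rmorph1.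
move: xy; move: (x%:C)%C (y%:C)%C => {}x {}y xy.
rewrite /refl !upd_eq !upd_upd; case sq: (s q).
  have -> : upd s q true = s by rewrite -sq upd_id.
  by rewrite -[RHS]mul1r -xy; ring.
have -> : upd s q false = s by rewrite -sq upd_id.
by rewrite -[RHS]mul1r -xy; ring.
Qed.

Lemma pull_revK P c s : all (gate_ok P) c -> pull (rev c) (pull c s) = s.
Proof.
elim: c s => // g c IH s /= /andP[og oc].
by rewrite rev_cons -cats1 pull_cat /= (act_involutive _ og) IH.
Qed.

Lemma pull_Krev P c s : all (gate_ok P) c -> pull c (pull (rev c) s) = s.
Proof.
move=> ok; rewrite -{1}[c]revK (@pull_revK P) //.
by rewrite all_rev.
Qed.

Lemma sems_revK P c psi : all (gate_ok P) c -> sems (rev c) (sems c psi) = psi.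
Proof.
elim: c psi => // g c IH psi /= /andP[og oc].
by rewrite rev_cons -cats1 sems_cat IH //= (sem_involutive _ og).
Qed.

Lemma sems_Krev P c psi : all (gate_ok P) c -> sems c (sems (rev c) psi) = psi.
Proof.
move=> ok; rewrite -{1}[c]revK (@sems_revK P) //.
by rewrite all_rev.
Qed.

Lemma refl_add q x y psi phi s :
  refl q x y (psi \+ phi) s = refl q x y psi s + refl q x y phi s.
Proof. by rewrite /refl /=; case: ifP => _; ring. Qed.

Lemma sems_add c psi phi : sems c (psi \+ phi) = sems c psi \+ sems c phi.
Proof.
elim: c psi phi => // g c IH psi phi /=; rewrite -IH; congr sems.
by apply/funext => s; case: g => //= q x y; apply: refl_add.
Qed.

(* Cuccaro's ripple-carry adder: the carries are stored in place of the second
   summand. *)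
Fixpoint adder (z : nat) (vg : seq (nat * nat)) : seq gate :=
  if vg is (v, g) :: vg' then
    [:: Cnot z v; Cnot g z; Tof v z g] ++ adder g vg' ++
    [:: Tof v z g; Cnot g z; Cnot g v]
  else [::].

Lemma adder_classical z vg : all classical (adder z vg).
Proof. by elim: vg z => //= -[v g] vg IH z; rewrite /= all_cat IH. Qed.

Lemma size_adder z vg : size (adder z vg) = (6 * size vg)%N.
Proof. by elim: vg z => //= -[v g] vg IH z; rewrite /= size_cat IH /=; lia. Qed.

Lemma adder_ok P z vg : uniq (z :: unzip1 vg ++ unzip2 vg) ->
  all P (z :: unzip1 vg ++ unzip2 vg) -> all (gate_ok P) (adder z vg).
Proof.
elim: vg z => //= -[v g] vg IH z /=.
rewrite !inE !mem_cat !cat_uniq /= !inE !negb_or !all_cat /=.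
move=> /and3P[/and3P[zv z1 /andP[zg z2]] /andP[v1 /andP[vg' v2]]].
move=> /and4P[u1 /andP[g1 hv] g2 u2] /and4P[Pz Pv P1 /andP[Pg P2]].
have [vz gv gz] : [/\ v != z, g != v & g != z] by rewrite (eq_sym v) (eq_sym g v) (eq_sym g z).
rewrite /gate_ok /= !inE !negb_or ?zv ?zg ?vg' ?vz ?gv ?gz Pz Pv Pg /= andbT.
apply: IH => /=.
  by rewrite mem_cat negb_or g1 g2 cat_uniq u1 u2 hv.
by rewrite Pg all_cat P1 P2.
Qed.

Lemma pull_adder z vg s : uniq (z :: unzip1 vg ++ unzip2 vg) ->
  pull (adder z vg) s = addf (s z) vg s.
Proof.
elim: vg z s => //= -[v g] vg IH z s /=.
rewrite !inE !mem_cat !cat_uniq /= !inE !negb_or.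
move=> /and3P[/and3P[zv z1 /andP[zg z2]] /andP[v1 /andP[vg' v2]]].
move=> /and4P[u1 /andP[g1 hv] g2 u2].
rewrite pull_cat IH /=; last by rewrite mem_cat negb_or g1 g2 cat_uniq u1 u2 hv.
have [vz gv gz] : [/\ v != z, g != v & g != z] by rewrite (eq_sym v) (eq_sym g v) (eq_sym g z).
rewrite !(upd_eq, upd_neq) // !addf_upd // !(upd_eq, upd_neq) //.
(* Read from right to left, [Cnot g v], [Cnot g z] and [Tof v z g] leave in [g] the majority of the
   two bits and the carry. *)
set b := (_ (+) (_ && _)); have -> : b = if s v == s g then s v else s z.
  by rewrite /b; case: (s v) (s g) (s z) => [] [] [].
set t := addf _ _ _; have [tv tg tz] : [/\ t v = s v, t g = s g & t z = s z].
  by rewrite /t !addf_out.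
apply/funext => r; rewrite /upd; have [_|_] := eqVneq r v.
  by case: (s v) (s g) (s z) => [] [] [].
have [->|_] := eqVneq r z.
  by rewrite tz; case: (s v) (s g) (s z) => [] [] [].
have [->|//] := eqVneq r g.
by rewrite tg; case: (s v) (s g) (s z) => [] [] [].
Qed.

Fact cadd_key : unit. Proof. exact: tt. Qed.
(** On configurations: add the second summand with carry-in [c], then subtract it with carry-in [z],
    which is zero. Only the carry [c] survives, whatever the second summand holds, so dirty qubits
    can be borrowed for it. *)
Definition cadd : nat -> nat -> seq (nat * nat) -> seq gate :=
  locked_with cadd_key (fun c z vg => rev (adder z vg) ++ adder c vg).

Lemma caddE c z vg : cadd c z vg = rev (adder z vg) ++ adder c vg.
Proof. by rewrite /cadd unlock. Qed.

Lemma cadd_classical c z vg : all classical (cadd c z vg).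
Proof. by rewrite caddE all_cat all_rev !adder_classical. Qed.

Lemma size_cadd c z vg : size (cadd c z vg) = (12 * size vg)%N.
Proof. by rewrite caddE size_cat size_rev !size_adder; lia. Qed.

Lemma cadd_ok P c z vg : uniq (c :: z :: unzip1 vg ++ unzip2 vg) ->
  all P (c :: z :: unzip1 vg ++ unzip2 vg) -> all (gate_ok P) (cadd c z vg).
Proof.
rewrite 2!cons_uniq inE negb_or => /and3P[/andP[_ nc] nz u] /and3P[Pc Pz Pv].
by rewrite caddE all_cat all_rev !adder_ok //= ?nc ?nz ?Pc ?Pz.
Qed.

Lemma pull_cadd c z vg s : uniq (c :: z :: unzip1 vg ++ unzip2 vg) ->
  s z = false ->
  pull (cadd c z vg) s = if s c then inc (unzip1 vg) s else s.
Proof.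
rewrite 2!cons_uniq inE negb_or => /and3P[/andP[_ nc] nz u] sz.
have uc : uniq (c :: unzip1 vg ++ unzip2 vg) by rewrite /= nc.
have uz : uniq (z :: unzip1 vg ++ unzip2 vg) by rewrite /= nz.
have okz : all (gate_ok predT) (adder z vg) by apply: adder_ok => //; rewrite all_predT.
rewrite caddE pull_cat pull_adder //.
have K t : t z = false -> pull (rev (adder z vg)) (addf false vg t) = t.
  by move=> tz; rewrite -{1}tz -pull_adder // (pull_revK _ okz).
move: u; rewrite cat_uniq => /and3P[u1 dis _].
move: nz; rewrite mem_cat negb_or => /andP[nz _].
case: ifP => _; last exact: K.
by rewrite addf_carry // K // inc_out.
Qed.

(** Each adder, hence also its inverse, writes only on the first summand. No condition on [s z] is
    imposed, so that cleanness can be carried through configurations with a dirty [z]. *)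
Lemma pull_cadd_out c z vg s q : uniq (c :: z :: unzip1 vg ++ unzip2 vg) ->
  q \notin unzip1 vg -> pull (cadd c z vg) s q = s q.
Proof.
rewrite 2!cons_uniq inE negb_or => /and3P[/andP[_ nc] nz u] nq.
have uc : uniq (c :: unzip1 vg ++ unzip2 vg) by rewrite /= nc.
have uz : uniq (z :: unzip1 vg ++ unzip2 vg) by rewrite /= nz.
have okz : all (gate_ok predT) (adder z vg) by apply: adder_ok => //; rewrite all_predT.
rewrite caddE pull_cat; set t := pull (adder c vg) s.
have -> : s q = t q by rewrite /t pull_adder // addf_out.
by rewrite -[t in RHS](pull_Krev t okz) [in RHS]pull_adder // addf_out.
Qed.

End Circuits.

(** * Controlled increments *)

Lemma subseq_unzip1_zip (S T : eqType) (s : seq S) (t : seq T) :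
  subseq (unzip1 (zip s t)) s.
Proof. by elim: s t => [|x s IH] [|y t] //=; rewrite ?sub0seq // eqxx IH. Qed.

Lemma subseq_unzip2_zip (S T : eqType) (s : seq S) (t : seq T) :
  subseq (unzip2 (zip s t)) t.
Proof. by elim: s t => [|x s IH] [|y t] //=; rewrite ?sub0seq // eqxx IH. Qed.

Lemma subseq_zip (T : eqType) (s t : seq T) :
  subseq (unzip1 (zip s t) ++ unzip2 (zip s t)) (s ++ t).
Proof. by apply: cat_subseq; rewrite ?subseq_unzip1_zip ?subseq_unzip2_zip. Qed.

Section Lattice.
Variable R : realType.
Local Notation C := (R[i]).
Local Notation gate := (gate R).

(* Conditional increment of [A ++ B] controlled by [c].  Each half serves as
   the borrowed summand of the adders acting on the other half, with [D] as a
   reserve; [e] receives the carry out of [A]; [z] is a zero carry input. *)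
Definition hinc (c e z : nat) (A B D : seq nat) : seq gate :=
  cadd R c z (zip A (B ++ D)) ++
  rev (cadd R c z (zip (rcons A e) (B ++ D))) ++
  cadd R e z (zip B (A ++ D)) ++
  cadd R c z (zip (rcons A e) (B ++ D)).

Lemma hinc_classical c e z A B D : all (@classical R) (hinc c e z A B D).
Proof. by rewrite !all_cat all_rev !cadd_classical. Qed.

Lemma size_hinc c e z A B D :
  (size (hinc c e z A B D) <= 48 * (size A + size B).+1)%N.
Proof.
rewrite !size_cat size_rev !size_cadd !size_zip !size_rcons.
by have := geq_minl (size A) (size (B ++ D)); have := geq_minl (size A).+1 (size (B ++ D));
  have := geq_minl (size B) (size (A ++ D)); lia.
Qed.

Section Hinc.
Variables (c e z : nat) (A B D : seq nat).
Hypothesis uni : uniq (c :: e :: z :: A ++ B ++ D).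

Let sub_uniq (s t : seq nat) :
  perm_eq t (c :: e :: z :: A ++ B ++ D) -> subseq s t -> uniq s.
Proof. by move=> pe /subseq_uniq; apply; rewrite (perm_uniq pe). Qed.

Let u1 : uniq [:: c, z & unzip1 (zip (rcons A e) (B ++ D)) ++
                         unzip2 (zip (rcons A e) (B ++ D))].
Proof.
apply: (@sub_uniq _ [:: c, z & rcons A e ++ (B ++ D)]); last first.
  by apply: (@cat_subseq _ [:: c; z] _ [:: c; z]) => //; apply: subseq_zip.
by apply/permP => P; rewrite /= -cats1 !count_cat /=; lia.
Qed.

Let u2 : uniq [:: e, z & unzip1 (zip B (A ++ D)) ++ unzip2 (zip B (A ++ D))].
Proof.
apply: (@sub_uniq _ [:: c, e, z & B ++ (A ++ D)]); last first.
  by apply: (@cat_subseq _ [:: e; z] _ [:: c; e; z]); rewrite ?subseq_zip // subseq_cons.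
by apply/permP => P; rewrite /= !count_cat /=; lia.
Qed.

Let u4 : uniq [:: c, z & unzip1 (zip A (B ++ D)) ++ unzip2 (zip A (B ++ D))].
Proof.
apply: (@sub_uniq _ [:: e, c, z & A ++ (B ++ D)]); last first.
  by apply: (@cat_subseq _ [:: c; z] _ [:: e; c; z]); rewrite ?subseq_zip // subseq_cons.
by apply/permP => P; rewrite /= !count_cat /=; lia.
Qed.

Lemma hinc_ok P : all P (c :: e :: z :: A ++ B ++ D) ->
  all (gate_ok P) (hinc c e z A B D).
Proof.
move=> /=; rewrite !all_cat all_rev => /and5P[Pc Pe Pz PA /andP[PB PD]].
have sub s t : all P s -> all P t -> all P (unzip1 (zip s t) ++ unzip2 (zip s t)).
  by move=> Ps Pt; apply/allP => x /(mem_subseq (subseq_zip s t));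
    rewrite mem_cat => /orP[]; [apply: (allP Ps)|apply: (allP Pt)].
by rewrite !cadd_ok //= ?Pc ?Pe ?Pz /= sub // ?all_rcons ?all_cat ?Pe ?PA ?PB ?PD.
Qed.

Hypothesis sA : (size A < size B + size D)%N.
Hypothesis sB : (size B <= size A + size D)%N.

(** Read from right to left: [A] is incremented with [e] as its top bit, [B] is incremented under
    [e], the first step is undone, and [A] is incremented without [e]. Undoing before the last step
    is what restores [e]. *)
Lemma pull_hinc s : s z = false ->
  let t := if (if s c then inc (rcons A e) s else s) e then inc B s else s in
  pull (hinc c e z A B D) s = if s c then inc A t else t.
Proof.
move=> sz t; rewrite !pull_cat.
have [a1 a2 a4] : [/\ unzip1 (zip (rcons A e) (B ++ D)) = rcons A e,
    unzip1 (zip B (A ++ D)) = B & unzip1 (zip A (B ++ D)) = A].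
  by split; apply: unzip1_zip; rewrite ?size_rcons size_cat; lia.
have ok : all (gate_ok predT) (cadd R c z (zip (rcons A e) (B ++ D))).
  by rewrite cadd_ok // all_predT.
move: (uni) => /= /and4P[].
rewrite !inE !negb_or !mem_cat !negb_or => /and4P[ce cz cA /andP[cB cD]].
move=> /and3P[ez eA /andP[eB eD]] /and3P[zA zB zD]; rewrite !cat_uniq => /and3P[uA dis _].
have zAe : z \notin rcons A e by rewrite mem_rcons inE negb_or eq_sym ez.
have cAe : c \notin rcons A e by rewrite mem_rcons inE negb_or ce.
have tz : t z = false by rewrite /t; case: ifP; rewrite ?inc_out.
have tc : t c = s c by rewrite /t; case: ifP; rewrite ?inc_out.
(* The increment of [B] commutes with that of [rcons A e], so the latter can be cancelled although
   it was done earlier. *)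
suff -> : pull (cadd R e z (zip B (A ++ D)))
      (pull (cadd R c z (zip (rcons A e) (B ++ D))) s) =
    pull (cadd R c z (zip (rcons A e) (B ++ D))) t.
  by rewrite (pull_revK _ ok) pull_cadd // a4 tc.
rewrite !pull_cadd // a1 ?a2 ?tc //; last by case: ifP; rewrite ?inc_out.
rewrite /t; case: (s c) => //; case: ifP => // _; rewrite away_comm //.
apply: away_inc; apply/hasPn => q qB; apply/negP => /=.
rewrite mem_rcons inE => /orP[/eqP qe|qA]; first by rewrite -qe qB in eB.
by move/hasPn: dis => /(_ q); rewrite mem_cat qB /= => /(_ isT); rewrite qA.
Qed.

Lemma pull_hinc_out s : pull (hinc c e z A B D) s z = s z.
Proof.
move: (uni) => /= /and4P[].
rewrite !inE !negb_or !mem_cat !negb_or => /and4P[ce cz cA /andP[cB cD]].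
move=> /and3P[ez eA /andP[eB eD]] /and3P[zA zB zD] _.
have ok : all (gate_ok predT) (cadd R c z (zip (rcons A e) (B ++ D))).
  by rewrite cadd_ok // all_predT.
have n (T : seq nat) (V : seq nat) : z \notin T -> z \notin unzip1 (zip T V).
  by apply: contraNN; apply/mem_subseq/subseq_unzip1_zip.
have zAe : z \notin rcons A e by rewrite mem_rcons inE negb_or eq_sym ez.
rewrite !pull_cat pull_cadd_out ?n //.
rewrite -[LHS](pull_cadd_out R _ u1) ?n // (pull_Krev _ ok).
by rewrite !pull_cadd_out ?n.
Qed.

End Hinc.

Definition clean (qs : seq nat) (psi : (nat -> bool) -> C) : Prop :=
  forall s, has s qs -> psi s = 0%R.

Lemma clean_sub qs rs psi : {subset rs <= qs} -> clean qs psi -> clean rs psi.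
Proof.
move=> sub cl s /hasP[q /sub qs' sq]; apply: cl.
by apply/hasP; exists q.
Qed.

(** If [e] or [z] is set, both sides are zero, since both bits are preserved and [psi] is clean.
    Otherwise [e] starts at zero and receives exactly the carry out of [A]. *)
Lemma sems_hinc c e z A B D psi :
  uniq (c :: e :: z :: A ++ B ++ D) ->
  (size A < size B + size D)%N -> (size B <= size A + size D)%N ->
  clean [:: e; z] psi ->
  sems (hinc c e z A B D) psi = fun s => psi (if s c then inc (A ++ B) s else s).
Proof.
move=> uni sA sB cl; rewrite sems_classical ?hinc_classical //.
apply/funext => s /=.
move: (uni) => /= /and4P[].
rewrite !inE !negb_or !mem_cat !negb_or => /and4P[ce cz cA /andP[cB cD]].
move=> /and3P[ez eA /andP[eB eD]] /and3P[zA zB zD]; rewrite !cat_uniq => /and3P[uA _ _].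
have zAB : z \notin A ++ B by rewrite mem_cat negb_or zA.
have eAB : e \notin A ++ B by rewrite mem_cat negb_or eA.
case sz: (s z).
  rewrite [LHS]cl /=; last by rewrite pull_hinc_out // sz !orbT.
  by rewrite [RHS]cl //=; case: ifP => _; rewrite ?inc_out // sz !orbT.
rewrite pull_hinc //=; set t := (if (if s c then inc (rcons A e) s else s) e then _ else _).
have te : t e = s e by rewrite /t; case: ifP => _; rewrite ?inc_out.
case se: (s e).
  rewrite [LHS]cl /=; last by case: ifP => _; rewrite ?inc_out // te se.
  by rewrite [RHS]cl //=; case: ifP => _; rewrite ?inc_out // se.
congr psi; rewrite /t; case sc: (s c); last by rewrite se.
rewrite -cats1 !inc_cat //=; case: (all s A); last by rewrite inc_out // se.
rewrite inc_out // se upd_eq away_comm //.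
apply: away_inc; move: (uni); rewrite !cons_uniq => /and4P[_ _ _].
rewrite catA cat_uniq => /and3P[+ _ _]; rewrite cat_uniq => /and3P[_ + _].
by move=> /hasPn h; apply/hasPn => q qA; apply/negP => /= /h /=; rewrite qA.
Qed.

(** Each [k] temporarily holds the conjunction of the control with the bits passed so far and is
    then uncomputed. The top two bits need no such carry, so two fewer ancillas than bits
    suffice. *)
Fixpoint ripple (p : nat) (qs ks : seq nat) {struct ks} : seq gate :=
  if ks is k :: ks' then
    if qs is x :: qs' then
      Cnot R p x :: Tof R p x k :: rcons (ripple k qs' ks') (Tof R p x k)
    else [::]
  else match qs with
    | [:: x] => [:: Cnot R p x]
    | [:: x; y] => [:: Cnot R p x; Tof R p x y]
    | _ => [::]
  end.

Lemma ripple_classical p qs ks : all (@classical R) (ripple p qs ks).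
Proof.
elim: ks p qs => [|k ks IH] p [|x qs] //=; last by rewrite all_rcons IH.
by case: qs => [|y [|? ?]].
Qed.

Lemma size_ripple p qs ks : (size (ripple p qs ks) <= 3 * size qs)%N.
Proof.
elim: ks p qs => [|k ks IH] p [|x qs] //=.
  by case: qs => [|y [|? ?]].
by rewrite size_rcons; have := IH k qs; lia.
Qed.

Let ripple_uniq (p x k : nat) qs ks : uniq (p :: (x :: qs) ++ k :: ks) ->
  [/\ [/\ p != x, p != k & x != k], p \notin qs, x \notin qs, k \notin qs &
      uniq (k :: qs ++ ks)].
Proof.
rewrite /= inE !mem_cat !inE !negb_or cat_uniq /= negb_or.
move=> /and3P[/and4P[px pqs pk _] /and3P[xqs xk _]] /and4P[uqs /andP[kqs dis] kks uks].
by split=> //; rewrite kqs kks /= cat_uniq uqs dis uks.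
Qed.

Lemma ripple_ok P p qs ks : uniq (p :: qs ++ ks) -> all P (p :: qs ++ ks) ->
  all (gate_ok P) (ripple p qs ks).
Proof.
elim: ks p qs => [|k ks IH] p [|x qs] //.
  rewrite cats0 /= => /andP[+ /andP[+ _]] /and3P[Pp Px].
  case: qs => [|y [|? ?]] //=; rewrite !inE ?negb_or /gate_ok /= ?inE ?negb_or.
    by move=> px _ _; rewrite px Pp Px.
  move=> /andP[px py] xy /andP[Py _].
  by rewrite px py xy Pp Px Py.
move=> /ripple_uniq[[px pk xk] _ _ _ u] /= /and3P[Pp Px].
rewrite all_cat /= => /and3P[Pqs Pk Pks].
rewrite all_rcons IH //; last by rewrite /= Pk all_cat Pqs.
by rewrite /gate_ok /= !inE !negb_or px pk xk Pp Px Pk.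
Qed.

Lemma pull_ripple p qs ks s : uniq (p :: qs ++ ks) -> (size qs <= (size ks).+2)%N ->
  ~~ has s ks -> pull (ripple p qs ks) s = if s p then inc qs s else s.
Proof.
elim: ks p qs s => [|k ks IH] p [|x qs] s; rewrite ?if_same // => u sz cl.
  case: qs u sz => [|y [|//]] u _ /=.
    by case: (s p); case sx: (s x); rewrite ?addbF //= -?sx ?upd_id.
  move: u; rewrite /= !inE !negb_or => /and3P[/andP[px py] /= xy _].
  have yx : y != x by rewrite eq_sym.
  rewrite !upd_neq //.
  case: (s p) => /=; last by rewrite !addbF !upd_id.
  case sx: (s x) => /=; last by rewrite addbF upd_id.
  rewrite addbT updC //.
  by case: (s y).
case/ripple_uniq: u => -[px pk xk] pqs xqs kqs u.
move: cl; rewrite /= negb_or => /andP[/negbTE sk cl].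
rewrite -cats1 pull_cat IH //=; last first.
  apply/hasPn => q qks /=; rewrite upd_neq; first by move/hasPn: cl => /(_ q qks).
  by apply: contraTneq u => <-; rewrite /= mem_cat qks orbT.
rewrite upd_eq sk /=; set b := s p && s x.
set t := (if b then inc qs (upd s k b) else upd s k b).
have -> : t = upd (if b then inc qs s else s) k b.
  by rewrite /t; case: (b); rewrite ?inc_upd.
set v := (if b then inc qs s else s).
have [vx vp vk] : [/\ v x = s x, v p = s p & v k = false].
  by rewrite /v; case: (b); rewrite ?inc_out.
rewrite !(upd_eq, upd_neq) // vx vp -/b addbb upd_upd.
have -> : upd v k false = v by rewrite -vk upd_id.
rewrite /v /b; case: (s p) => /=; last by rewrite addbF upd_id.
by case: (s x); rewrite ?inc_upd.
Qed.

Lemma pull_ripple_out p qs ks s q : uniq (p :: qs ++ ks) ->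
  q \notin qs -> pull (ripple p qs ks) s q = s q.
Proof.
elim: ks p qs s q => [|k ks IH] p [|x qs] s q // u.
  case: qs u => [|y [|//]] _ /=; rewrite !inE ?negb_or.
    by move=> qx; rewrite upd_neq.
  by move=> /andP[qx qy]; rewrite !upd_neq.
case/ripple_uniq: u => -[px pk xk] pqs xqs kqs u.
rewrite inE negb_or => /andP[qx nq].
rewrite /= upd_neq // -cats1 pull_cat /=; have [->|qk] := eqVneq q k.
  rewrite upd_eq !IH // !(upd_eq, upd_neq) //.
  by rewrite -addbA addbb addbF.
by rewrite upd_neq // IH // upd_neq.
Qed.

Lemma sems_ripple p qs ks psi : uniq (p :: qs ++ ks) -> (size qs <= (size ks).+2)%N ->
  clean ks psi ->
  sems (ripple p qs ks) psi = fun s => psi (if s p then inc qs s else s).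
Proof.
move=> u sz cl; rewrite sems_classical ?ripple_classical //; apply/funext => s /=.
case: (boolP (has s ks)) => [d|nd]; last by rewrite pull_ripple.
have out q : q \in ks -> q \notin qs.
  by move=> qks; move: u; rewrite /= cat_uniq => /and4P[_ _ /hasPn h _]; apply: h.
case/hasP: d => q qks sq; rewrite !cl //; apply/hasP; exists q => //.
  by case: ifP => _; rewrite ?inc_out ?out.
by rewrite pull_ripple_out ?out.
Qed.

End Lattice.

(** * Lattices and their support *)

Section LatticeOperator.
Variable R : realType.
Local Notation C := (R[i]).
Local Notation gate := (gate R).
Local Open Scope ring_scope.

Definition cond (p : nat) (f : (nat -> bool) -> nat -> bool)
    (psi : (nat -> bool) -> C) : (nat -> bool) -> C :=
  fun s => psi (if s p then f s else s).

(** [Refl p 1 0] is diag(1, -1); after [Refl p x y] it yields the rotation [[x, y], [-y, x]]. The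
    last factor stays a reflection, which supplies the signs of the high-pass row. *)
Fixpoint latop (ths : seq (R * R)) (th : R * R) (p : nat)
    (f : (nat -> bool) -> nat -> bool) (psi : (nat -> bool) -> C) : (nat -> bool) -> C :=
  if ths is t :: ths' then
    latop ths' th p f (cond p f (sem (Refl p 1 0) (sem (Refl p t.1 t.2) psi)))
  else sem (Refl p th.1 th.2) psi.

Fixpoint lat (ths : seq (R * R)) (th : R * R) (p : nat) (qs ks : seq nat) : seq gate :=
  if ths is t :: ths' then
    [:: Refl p t.1 t.2; Refl p 1 0] ++ ripple R p qs ks ++ lat ths' th p qs ks
  else [:: Refl p th.1 th.2].

Definition unit_pair (t : R * R) : bool := t.1 ^+ 2 + t.2 ^+ 2 == 1.

Lemma size_lat ths th p qs ks :
  (size (lat ths th p qs ks) <= (3 * size qs + 2) * (size ths).+1)%N.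
Proof.
elim: ths => [|t ths IH] /=; first by lia.
by rewrite size_cat; have := size_ripple R p qs ks; lia.
Qed.

Lemma lat_ok P ths th p qs ks : all unit_pair (th :: ths) ->
  uniq (p :: qs ++ ks) -> all P (p :: qs ++ ks) -> all (gate_ok P) (lat ths th p qs ks).
Proof.
move=> + u PP; have Pp : P p by case/andP: PP.
elim: ths => [|t ths IH] /=; rewrite /gate_ok /= Pp.
  by rewrite !andbT /unit_pair => ->.
move=> /and3P[uth ut uths]; rewrite [_ == 1]ut expr1n expr0n /= addr0 eqxx /=.
by rewrite all_cat ripple_ok // IH //= uth.
Qed.

Definition van (Z : (nat -> bool) -> bool) (psi : (nat -> bool) -> C) : Prop :=
  forall s, Z s -> psi s = 0.

Lemma van_refl p x y Z psi : (forall s b, Z (upd s p b) = Z s) ->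
  van Z psi -> van Z (refl p x y psi).
Proof.
move=> Zp van0 s Zs; rewrite /refl !van0 ?Zp // !mulr0 subr0 addr0.
by case: ifP.
Qed.

(** [Z j] is a set on which the amplitudes vanish after [j] delays. A delayed amplitude at [s] is
    read off at [s] or at [f s], so both must lie in the previous set. *)
Lemma van_latop ths th p f psi (Z : nat -> (nat -> bool) -> bool) :
  (forall j s b, Z j (upd s p b) = Z j s) ->
  (forall j s, (j < size ths)%N -> Z j.+1 s -> Z j s && Z j (f s)) ->
  van (Z 0%N) psi -> van (Z (size ths)) (latop ths th p f psi).
Proof.
elim: ths psi Z => [|t ths IH] psi Z Zp Zf v0 /=; first exact: van_refl.
apply: (IH _ (fun j => Z j.+1)) => [j s b|j s lt|s Zs]; first exact: Zp.
  exact: Zf.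
have /andP[Z0 Z0f] := Zf 0%N s isT Zs.
have v1 : van (Z 0%N) (sem (Refl p 1 0) (sem (Refl p t.1 t.2) psi)).
  by do 2![apply: van_refl => //].
by rewrite /cond; case: ifP => _; apply: v1.
Qed.

Lemma latop_eq_on ths th p f psi phi (Z : (nat -> bool) -> bool) :
  (forall s b, Z (upd s p b) = Z s) -> (forall s, Z s -> Z (f s)) ->
  (forall s, Z s -> psi s = phi s) ->
  forall s, Z s -> latop ths th p f psi s = latop ths th p f phi s.
Proof.
move=> Zp Zf.
have reflE x y (psi1 psi2 : (nat -> bool) -> C) : (forall s, Z s -> psi1 s = psi2 s) ->
    forall s, Z s -> refl p x y psi1 s = refl p x y psi2 s.
  by move=> e s Zs; rewrite /refl !e ?Zp.
elim: ths psi phi => [|t ths IH] psi phi e s Zs /=; first exact: reflE.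
apply: (IH _ _ _ s Zs) => u Zu; rewrite /cond.
apply: (reflE); last by case: ifP => _ //; apply: Zf.
exact: reflE.
Qed.

Lemma clean_refl qs p x y (psi : (nat -> bool) -> C) : p \notin qs -> clean qs psi -> clean qs (refl p x y psi).
Proof.
move=> np; apply: (@van_refl p x y (fun s => has s qs)) => s b.
apply: eq_in_has => q qqs; apply: upd_neq.
by apply: contraNneq np => <-.
Qed.

Lemma clean_cond ks p f (psi : (nat -> bool) -> C) : (forall s q, q \in ks -> f s q = s q) ->
  clean ks psi -> clean ks (cond p f psi).
Proof.
move=> fk cl s /hasP[q qks sq]; apply: cl; apply/hasP; exists q => //.
by case: ifP => _; rewrite ?fk.
Qed.

Lemma clean_latop ks ths th p f psi : p \notin ks ->
  (forall s q, q \in ks -> f s q = s q) ->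
  clean ks psi -> clean ks (latop ths th p f psi).
Proof.
move=> np fk; elim: ths psi => [|t ths IH] psi cl /=; first exact: clean_refl.
by apply/IH/clean_cond => //; do 2![apply: clean_refl => //].
Qed.

Lemma sems_lat ths th p qs ks psi : uniq (p :: qs ++ ks) ->
  (size qs <= (size ks).+2)%N -> clean ks psi ->
  sems (lat ths th p qs ks) psi = latop ths th p (inc qs) psi.
Proof.
move=> u sz; have np : p \notin ks.
  by move: u => /= /andP[+ _]; rewrite mem_cat negb_or => /andP[].
have out s q : q \in ks -> inc qs s q = s q.
  move=> qks; apply: inc_out.
  by move: u => /= /andP[_]; rewrite cat_uniq => /and3P[_ /hasPn h _]; apply: h.
elim: ths psi => [//|t ths IH] psi cl.
have cl' : clean ks (sem (Refl p 1 0) (sem (Refl p t.1 t.2) psi)).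
  by do 2![apply: clean_refl => //].
rewrite -[LHS]/(sems (ripple R p qs ks ++ lat ths th p qs ks)
  (sem (Refl p 1 0) (sem (Refl p t.1 t.2) psi))) sems_cat sems_ripple //.
by apply: IH; apply: clean_cond.
Qed.

Lemma van_rev_lat ths th p qs ks psi (Z : nat -> (nat -> bool) -> bool) :
  all unit_pair (th :: ths) -> uniq (p :: qs ++ ks) -> (size qs <= (size ks).+2)%N ->
  (forall j s b, Z j (upd s p b) = Z j s) ->
  (forall j s, (j < size ths)%N -> Z j.+1 s -> Z j s) ->
  (forall j s, (j < size ths)%N -> Z j.+1 (inc qs s) -> Z j s) ->
  clean ks psi -> van (Z 0%N) psi ->
  clean ks (sems (rev (lat ths th p qs ks)) psi) /\
  van (Z (size ths)) (sems (rev (lat ths th p qs ks)) psi).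
Proof.
move=> + u sz Zp + + cl v0; have np : p \notin ks.
  by move: u => /= /andP[+ _]; rewrite mem_cat negb_or => /andP[].
have out q : q \in ks -> q \notin qs.
  move=> qks.
  by move: u => /= /andP[_]; rewrite cat_uniq => /and3P[_ /hasPn h _]; apply: h.
have rok : all (gate_ok predT) (ripple R p qs ks) by rewrite ripple_ok // all_predT.
elim: ths => [|t ths IH] /=.
  by move=> _ _ _; split; [apply: clean_refl|apply: van_refl].
move=> /and3P[uth ut uths] Z1 Z2; have [] := IH.
- by rewrite /= uth.
- by move=> j s lt; apply: Z1; apply: ltnW.
- by move=> j s lt; apply: Z2; apply: ltnW.
rewrite !rev_cons rev_cat -!cats1 !sems_cat.
set chi := sems (rev (lat _ _ _ _ _)) psi => clc vc.
set phi := sems (rev (ripple _ _ _ _)) chi.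
have phiE s : phi s = chi (pull (rev (ripple R p qs ks)) s).
  by rewrite /phi sems_classical // all_rev ripple_classical.
suff [clp vp] : clean ks phi /\ van (Z (size ths).+1) phi.
  by split; [do 2![apply: clean_refl => //]|do 2![apply: van_refl => //]].
split=> s; rewrite phiE; set t' := pull (rev _) s.
  have -> : s = pull (ripple R p qs ks) t' by rewrite (pull_Krev _ rok).
  case/hasP=> q qks; rewrite pull_ripple_out ?out // => tq.
  by apply: clc; apply/hasP; exists q.
have -> : s = pull (ripple R p qs ks) t' by rewrite (pull_Krev _ rok).
case: (boolP (has t' ks)) => [d _|nd]; first exact: clc.
by rewrite pull_ripple //; case: ifP => _ Zt; apply: vc; [apply: Z2 Zt|apply: Z1 Zt].
Qed.

Lemma sems_away P (c : seq gate) f psi qs : all (gate_ok P) c -> {subset P <= qs} -> away qs f ->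
  sems c (psi \o f) = sems c psi \o f.
Proof.
move=> + sub [f1 f2]; elim: c psi => //= g c IH psi /andP[og oc].
rewrite -IH //; congr sems; apply/funext => s /=.
case/and3P: og => _ aP _; have {}aP q : q \in qubits g -> q \in qs.
  by move=> qg; apply/sub/(allP aP).
by case: g aP => [a b|a b d|q x y] aP /=; rewrite /refl /= ?f1 ?f2 ?aP //= !inE eqxx ?orbT.
Qed.

(** * Collapsing the extended register onto the full one *)

Section Collapse.
Variables (p c c' : nat) (lo : seq nat) (f : (nat -> bool) -> nat -> bool).
Let Q := lo ++ [:: c; c'].
Hypothesis uni : uniq (p :: Q).
Hypothesis awf : away (p :: Q) f.
Variable W : nat.
Hypothesis WE : (2 ^ size lo)%N = W.

Definition blk (b : bool) (s : nat -> bool) : nat -> bool := upd (upd s c b) c' b.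

(* The extended register reaches block 3 (that is, -1) exactly when the full
   register carries into the high part. *)
Definition col (psi : (nat -> bool) -> C) (s : nat -> bool) : C :=
  psi (blk false s) + psi (f (blk true s)).

(** With [f] the increment of the high part this is the increment of the whole register; with [f]
    the identity it is the increment of [lo] modulo [W]. Both instances are used. *)
Definition incf (s : nat -> bool) : nat -> bool :=
  if all s lo then f (inc lo s) else inc lo s.

Let facts : [/\ [/\ p != c, p != c' & c != c'], p \notin lo, c \notin lo, c' \notin lo & uniq lo].
Proof.
move: uni; rewrite /= mem_cat cat_uniq /= !inE !negb_or.
by move=> /andP[/and3P[pl pc pc'] /and3P[ul /and3P[cl cl' _] /andP[cc _]]].
Qed.

Let cQ : c \in p :: Q. Proof. by rewrite inE mem_cat !inE eqxx !orbT. Qed.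
Let c'Q : c' \in p :: Q. Proof. by rewrite inE mem_cat !inE eqxx !orbT. Qed.
Let pQ : p \in p :: Q. Proof. exact: mem_head. Qed.

Lemma f_blk b s : f (blk b s) = blk b (f s).
Proof. by case: awf => f1 _; rewrite /blk !f1. Qed.

Lemma blk_blk b b' s : blk b (blk b' s) = blk b s.
Proof.
apply/funext => r; rewrite /blk /upd.
by case: (r == c'); case: (r == c).
Qed.

Lemma blk_upd b s q x : q != c -> q != c' -> blk b (upd s q x) = upd (blk b s) q x.
Proof. by move=> qc qc'; rewrite /blk (updC _ _ _ qc) (updC _ _ _ qc'). Qed.

Lemma blk_p b s : blk b s p = s p.
Proof. by case: facts => -[pc pc' _] _ _ _ _; rewrite /blk !upd_neq. Qed.

Lemma blk_inc b s : blk b (inc lo s) = inc lo (blk b s).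
Proof. by case: facts => _ _ cl cl' _; rewrite /blk !inc_upd. Qed.

Lemma blk_lo b s : {in lo, blk b s =1 s}.
Proof.
case: facts => _ _ cl cl' _ q qlo; rewrite /blk !upd_neq //.
  by apply: contraNneq cl => <-.
by apply: contraNneq cl' => <-.
Qed.

Lemma numval_blk b s : numval Q (blk b s) = (numval lo s + 3 * b * W)%N.
Proof.
case: facts => -[_ _ cc] _ _ _ _.
rewrite /Q numval_cat /= (eq_numval (@blk_lo b s)) /blk upd_eq upd_neq // upd_eq.
by rewrite WE; clear; case: b => /=; lia.
Qed.

Lemma f_lo s : {in lo, f s =1 s}.
Proof.
case: awf => _ f2 q qlo; apply: f2.
by rewrite inE mem_cat qlo orbT.
Qed.

Lemma col_refl x y psi : col (refl p x y psi) = refl p x y (col psi).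
Proof.
case: facts => -[pc pc' _] _ _ _ _; case: awf => f1 f2.
apply/funext => s; rewrite /col /refl f2 // !blk_p.
by case: ifP => _; rewrite !blk_upd // !f1 //; ring.
Qed.

(** The values that cannot be reached from block 0 by at most [j] decrements modulo [4 * W]. *)
Definition outside (j : nat) (s : nat -> bool) : bool :=
  (W <= numval Q s)%N && (numval Q s + j < 4 * W)%N.

(** Only the case where all of [lo] is set needs an argument. Then the block 0 term on the left is
    read at value [W], and the block 3 term on the right at [3 * W]; both are zero, the latter
    because [j < W]. The remaining terms agree since incrementing -1 returns to block 0. *)
Lemma col_cond j psi : (j < W)%N -> van (outside j) psi ->
  col (cond p (inc Q) psi) = cond p incf (col psi).
Proof.
move=> jW v; case: (facts) => -[pc pc' cc] pl cl cl' ul; case: (awf) => f1 f2.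
have W0 : (0 < W)%N by rewrite -WE expn_gt0.
have uQ : uniq Q by case/andP: uni.
have szQ : (2 ^ size Q = 4 * W)%N.
  by rewrite size_cat /= expnD WE mulnC.
apply/funext => s; rewrite /col /cond f2 // !blk_p.
case: ifP => // sp; rewrite /incf.
have allb t : {in lo, t =1 s} -> all t lo = all s lo by exact: eq_in_all.
have fb : {in lo, f (blk true s) =1 s} by move=> q qlo; rewrite f_lo // blk_lo.
have awlo : away lo f by apply: away_sub awf => q; rewrite inE mem_cat => ->; rewrite orbT.
case: (boolP (all s lo)) => [al|nal]; last first.
  rewrite !inc_cat // (allb _ fb) (allb _ (@blk_lo false s)) (negbTE nal).
  by rewrite (away_comm _ awlo) !blk_inc.
have nv : ((numval lo s).+1 = W)%N by apply/eqP; rewrite -WE -all_numval.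
rewrite [X in X + _]v; last first.
  rewrite /outside numval_inc // szQ numval_blk mul0n addn0 nv.
  by move: jW W0; clear; case: eqP; lia.
rewrite [X in _ = _ + X]v; last first.
  rewrite /outside f_blk numval_blk (eq_numval (@f_lo _)) (eq_numval (@f_lo _)).
  by rewrite numval_inc // WE nv eqxx; move: jW; clear; lia.
rewrite add0r addr0; congr psi.
rewrite inc_cat // (allb _ fb) al (away_comm _ awlo) -blk_inc.
set u := inc lo s; rewrite f_blk /=.
have [-> ->] : blk true (f u) c = true /\ upd (blk true (f u)) c false c' = true.
  by rewrite /blk upd_neq // !upd_eq upd_neq 1?eq_sym // upd_eq.
by rewrite -/(blk false (blk true (f u))) blk_blk.
Qed.

Lemma col_latop ths th psi : (size ths <= W)%N -> van (outside 0) psi ->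
  col (latop ths th p (inc Q) psi) = latop ths th p incf (col psi).
Proof.
have uQ : uniq Q by case/andP: uni.
have pnQ : p \notin Q by case/andP: uni.
have szQ : (2 ^ size Q = 4 * W)%N by rewrite size_cat /= expnD WE mulnC.
have op j s b : outside j (upd s p b) = outside j s by rewrite /outside numval_upd.
suff gen j : (j + size ths <= W)%N -> van (outside j) psi ->
    col (latop ths th p (inc Q) psi) = latop ths th p incf (col psi) by apply: (gen 0%N).
elim: ths j psi => [|t ths IH] j psi; first by rewrite /= col_refl.
move=> sz v; rewrite /= -!col_refl.
have v' : van (outside j) (refl p (1%:C)%C (0%:C)%C (refl p (t.1%:C)%C (t.2%:C)%C psi)).
  by do 2![apply: van_refl => //].
move: sz; rewrite /= addnS => sz.
rewrite -(col_cond _ v') ?(IH j.+1) //; last by move: sz; clear; lia.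
move=> s /andP[o1 o2]; apply: v'; rewrite /outside.
case: ifP => _; rewrite ?numval_inc // ?szQ; move: o1 o2; clear; last by lia.
by case: eqP; lia.
Qed.

End Collapse.
End LatticeOperator.

(** * The lattice with a single long increment *)

Section Core.
Variable R : realType.
Local Notation C := (R[i]).
Local Notation gate := (gate R).
Local Open Scope ring_scope.

Definition core (ths : seq (R * R)) (th : R * R) (p c c' z : nat)
    (ks lo A B : seq nat) : seq gate :=
  let F := lat ths th p (lo ++ [:: c; c']) (z :: ks) in
  F ++ (Cnot R c c' :: rcons (hinc R c c' z A B lo) (Cnot R c c')) ++ rev F ++
  lat ths th p lo (z :: ks).

Lemma size_core ths th p c c' z ks lo A B : (size (core ths th p c c' z ks lo A B) <=
  50 * (size A + size B).+1 + 3 * (3 * size lo + 8) * (size ths).+1)%N.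
Proof.
rewrite /core !size_cat size_rev /= size_rcons.
have := size_lat ths th p (lo ++ [:: c; c']) (z :: ks).
have := size_lat ths th p lo (z :: ks).
have := size_hinc R c c' z A B lo; rewrite size_cat /=; nia.
Qed.

Variables (ths : seq (R * R)) (th : R * R) (p c c' z : nat) (ks lo A B : seq nat).
Let Q := lo ++ [:: c; c'].
Let hi := A ++ B.
Let F := lat ths th p Q (z :: ks).
Hypothesis uni : uniq (p :: lo ++ hi ++ c :: c' :: z :: ks).
Hypothesis units : all (@unit_pair R) (th :: ths).

Let u_sub (s t : seq nat) :
  perm_eq t (p :: lo ++ hi ++ c :: c' :: z :: ks) -> subseq s t -> uniq s.
Proof. by move=> pe /subseq_uniq; apply; rewrite (perm_uniq pe). Qed.

Let uQk : uniq (p :: Q ++ z :: ks).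
Proof.
apply: (@u_sub _ (p :: hi ++ Q ++ z :: ks)).
  by apply/permP => P; rewrite /= !count_cat /=; lia.
rewrite -cat1s -[X in subseq _ X]cat1s; apply: cat_subseq => //.
exact: suffix_subseq.
Qed.

Let ulk : uniq (p :: lo ++ z :: ks).
Proof.
apply: (@u_sub _ (p :: (hi ++ [:: c; c']) ++ lo ++ z :: ks)).
  by apply/permP => P; rewrite /= !count_cat /=; lia.
rewrite -cat1s -[X in subseq _ X]cat1s; apply: cat_subseq => //.
exact: suffix_subseq.
Qed.

Let uhi : uniq (c :: c' :: z :: A ++ B ++ lo).
Proof.
apply: (@u_sub _ (p :: ks ++ c :: c' :: z :: A ++ B ++ lo)).
  by apply/permP => P; rewrite /hi /= !count_cat /= !count_cat; lia.
exact: (suffix_subseq (p :: ks)).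
Qed.

Lemma core_ok P : all P (p :: lo ++ hi ++ c :: c' :: z :: ks) ->
  all (gate_ok P) (core ths th p c c' z ks lo A B).
Proof.
rewrite /= !all_cat /= => /and5P[Pp Pl /andP[PA PB] Pc /and3P[Pc' Pz Pk]].
have okc : gate_ok P (Cnot R c c').
  rewrite /gate_ok /= inE Pc Pc' /= andbT.
  by move: uhi; rewrite andbT cons_uniq inE negb_or => /andP[/andP[]].
have okF : all (gate_ok P) F.
  by rewrite lat_ok //= Pp !all_cat /= Pl Pc Pc' Pz.
rewrite all_rcons okc all_rev [all _ (lat _ _ _ (_ ++ _) _)]okF /=.
by rewrite hinc_ok /= ?lat_ok //= ?Pp ?all_cat /= ?Pl ?Pc ?Pc' ?Pz ?PA ?PB.
Qed.

Variable W : nat.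
Hypothesis WE : (2 ^ size lo)%N = W.
Hypothesis sl : (size lo <= (size ks).+1)%N.
Hypothesis sA : (size A < size B + size lo)%N.
Hypothesis sB : (size B <= size A + size lo)%N.
Hypothesis sW : (size ths <= W)%N.

Let sQk : (size Q <= (size (z :: ks)).+2)%N.
Proof. by rewrite size_cat /= addn2. Qed.

Let szQ : (2 ^ size Q = 4 * W)%N.
Proof. by rewrite size_cat /= expnD WE mulnC. Qed.

Let facts : [/\ [/\ p != c, p != c' & c != c'], [/\ p \notin lo, c \notin lo & c' \notin lo],
  [/\ c \notin hi, c' \notin hi & p \notin hi], ~~ has (mem hi) (z :: ks) & p \notin z :: ks].
Proof.
move: uni; rewrite /= mem_cat cat_uniq has_cat cat_uniq mem_cat /= !inE !negb_or.
move=> /andP[/and5P[pl ph pc pc' /andP[pz pk]]].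
move=> /and5P[ul /and5P[_ cl cl' _ _] uh /and4P[ch c'h zh kh] /andP[/andP[cc' _] _]].
by split; rewrite // ?pc ?pz // (negbTE zh).
Qed.

Let uQ : uniq (p :: Q).
Proof. by apply: subseq_uniq uQk; rewrite -!cat_cons prefix_subseq. Qed.

Let awhi : away (p :: Q ++ z :: ks) (inc hi).
Proof.
case: facts => _ _ [ch c'h ph] kh _; apply: away_inc.
rewrite /= has_cat negb_or ph negb_or has_cat negb_or /= !negb_or ch c'h /=.
rewrite andbT (_ : has _ lo = false).
  by move: kh; rewrite /= negb_or.
apply/negbTE; move: uni; rewrite /= cat_uniq has_cat => /and4P[_ _ + _].
rewrite negb_or => /andP[/hasPn h _]; apply/hasPn => q ql; apply/negP => /= /h /=.
by rewrite ql.
Qed.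

Let blockE b s : (s c == b) && (s c' == b) -> blk c c' b s = s.
Proof. by case/andP => /eqP eb /eqP eb'; rewrite /blk -{1}eb upd_id -eb' upd_id. Qed.

Let numvalQ s : (numval Q s = numval lo s + (s c + 2 * s c') * W)%N.
Proof. by rewrite numval_cat /= WE; clear; lia. Qed.

(** In blocks 0 and 3 the two block bits agree, so the first CNOT clears [c'], which can then serve
    as the carry-out bit of the long increment while [c] controls it. This saves an ancilla. *)
Lemma sems_carry psi : clean (z :: ks) psi ->
  (forall s, s c != s c' -> psi s = 0) ->
  sems (Cnot R c c' :: rcons (hinc R c c' z A B lo) (Cnot R c c')) psi =
  fun s => psi (if s c then inc hi s else s).
Proof.
move=> cl sup; case: facts => -[_ _ cc'] _ [ch c'h _] kh _.
have zh : z \notin hi by move: kh; rewrite /= negb_or => /andP[].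
have nzc : z != c' by move: uhi; rewrite eq_sym /= !inE !negb_or => /and4P[_ /andP[]].
rewrite -cats1 -cat1s sems_cat sems_cat sems_hinc //; last first.
  move=> s /=; rewrite orbF => /orP[sc'|sz]; last by apply: cl; rewrite /= upd_neq // sz.
  by apply: sup; rewrite upd_eq upd_neq // sc'; case: (s c).
apply/funext => s /=; set u := upd s c' _; set v := (if u c then inc (A ++ B) u else u).
have vE : v = upd (if s c then inc hi s else s) c' (s c' (+) s c).
  by rewrite /v /u upd_neq //; case: (s c); rewrite ?inc_upd.
set t := (if s c then inc hi s else s) in vE *.
have [tc tc'] : t c = s c /\ t c' = s c' by rewrite /t; case sc: (s c); rewrite ?inc_out ?sc.
congr psi; rewrite vE upd_eq upd_neq // upd_upd tc -addbA addbb addbF -tc'.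
exact: upd_id.
Qed.

Lemma sems_core psi : clean (c :: c' :: z :: ks) psi ->
  sems (core ths th p c c' z ks lo A B) psi = latop ths th p (inc (lo ++ hi)) psi.
Proof.
move=> cl; case: (facts) => -[pc pc' cc'] [pl clo clo'] [ch c'h ph] kh pk.
have W0 : (0 < W)%N by rewrite -WE expn_gt0.
have pQ : p \notin Q by case/andP: uQ.
have uQ' : uniq Q by case/andP: uQ.
have ltl s : (numval lo s < W)%N by rewrite -WE numval_lt.
have clk : clean (z :: ks) psi by apply: clean_sub cl => q; rewrite !inE => ->; rewrite !orbT.
have okF : all (gate_ok (mem (p :: Q ++ z :: ks))) F by apply: lat_ok => //; apply/allP.
have kQ q : q \in z :: ks -> q \notin Q.
  by move=> qk; move: uQk; rewrite /= cat_uniq => /and4P[_ _ /hasPn h _]; apply: h.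
have klo q : q \in z :: ks -> q \notin lo.
  by move/kQ; apply: contraNN; rewrite mem_cat => ->.
have clF f : clean (z :: ks) f -> clean (z :: ks) (sems F f).
  by move=> clf; rewrite sems_lat //; apply: clean_latop => // s q /kQ; apply: inc_out.
have in_block f : (forall s, (W <= numval Q s)%N -> f s = 0) ->
    van (outside c c' lo W 0) f.
  by move=> h t /andP[+ _]; apply: h.
have slk : (size lo <= (size (z :: ks)).+2)%N by move: sl; clear; rewrite /=; lia.
have supp0 s : (W <= numval Q s)%N -> psi s = 0.
  rewrite numvalQ => le; apply: cl => /=.
  by move: (ltl s) le; clear; case: (s c) (s c') => [] [] //=; lia.
set phi := sems F psi.
have phiE : phi = latop ths th p (inc Q) psi by rewrite /phi sems_lat.
(* At most [W] delays, each lowering the support by at most one, lead from block 0 only into blocks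
   0 and 3. *)
have vphi s : (W <= numval Q s < 3 * W)%N -> phi s = 0.
  rewrite phiE => /andP[h1 h2].
  have := @van_latop R ths th p (inc Q) psi (outside c c' lo W); apply.
  - by move=> j u b; rewrite /outside numval_upd.
  - move=> j u lt; rewrite /outside -/Q => /andP[o1 o2]; rewrite numval_inc // szQ.
    by move: o1 o2 lt sW; clear; case: eqP; lia.
  - exact: in_block.
  by rewrite /outside -/Q h1; move: h2 sW; clear; lia.
pose chi0 s := if s c then 0 else phi s.
pose chi3 s := if s c then phi s else 0.
have phi_split : phi = chi0 \+ chi3.
  by apply/funext => s; rewrite /chi0 /chi3 /=; case: ifP; rewrite ?addr0 ?add0r.
have phi_blk s : s c != s c' -> phi s = 0.
  move=> ne; apply: vphi; rewrite numvalQ; move: (ltl s) ne; clear.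
  by case: (s c) (s c') => [] [] //=; lia.
have clphi : clean (z :: ks) phi by apply: clF.
have cl0 : clean (z :: ks) chi0 by move=> s /clphi e; rewrite /chi0 e; case: ifP.
have cl3 : clean (z :: ks) chi3 by move=> s /clphi e; rewrite /chi3 e; case: ifP.
set P0 := sems (rev F) chi0; set P3 := sems (rev F) chi3.
have PE : P0 \+ P3 = psi by rewrite -sems_add -phi_split (sems_revK _ okF).
have [clP0 vP0] : clean (z :: ks) P0 /\ forall s, (2 * W <= numval Q s)%N -> P0 s = 0.
  have [] := @van_rev_lat R ths th p Q (z :: ks) chi0 (fun j s => (W + j <= numval Q s)%N)
    units uQk sQk _ _ _ cl0 _.
  - by move=> j s b; rewrite numval_upd.
  - by move=> j s _; clear; lia.
  - by move=> j s lt; rewrite numval_inc // szQ; move: lt sW; clear; case: eqP; lia.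
  - move=> s; rewrite addn0 numvalQ /chi0 => le; case: ifP => // sc.
    by apply: phi_blk; move: (ltl s) le; rewrite sc; clear; case: (s c') => //=; lia.
  by move=> clP vP; split=> // s le; apply: vP; move: le sW; clear; lia.
have [clP3 vP3] : clean (z :: ks) P3 /\ forall s, (W <= numval Q s < 3 * W)%N -> P3 s = 0.
  have [] := @van_rev_lat R ths th p Q (z :: ks) chi3
    (fun j s => (j <= numval Q s < 3 * W)%N) units uQk sQk _ _ _ cl3 _.
  - by move=> j s b; rewrite numval_upd.
  - by move=> j s _; clear; lia.
  - move=> j s lt; rewrite numval_inc // szQ; have := numval_lt Q s; rewrite szQ.
    by move: lt sW; clear; case: eqP; lia.
  - move=> s /andP[_]; rewrite numvalQ /chi3 => le; case: ifP => // sc.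
    by apply: phi_blk; move: (ltl s) le; rewrite sc; clear; case: (s c') => //=; lia.
  by move=> clP vP; split=> // s /andP[le1 le2]; apply: vP; move: le1 le2 sW; clear; lia.
(* Block 1 can be reached only by [P0] and block 3 only by [P3]. As their sum [psi] vanishes on
   both, no cancellation is possible and each component vanishes there by itself. *)
have P0_block s : (W <= numval Q s)%N -> P0 s = 0.
  move=> le; have [lt|ge] := ltnP (numval Q s) (2 * W); last exact: vP0.
  have := congr1 (@^~ s) PE; rewrite /= supp0 // vP3 ?addr0 //.
  by move: le lt; clear; lia.
have P3_block s : (W <= numval Q s)%N -> P3 s = 0.
  move=> le; have [lt|ge] := ltnP (numval Q s) (3 * W); first by apply: vP3; rewrite le.
  have := congr1 (@^~ s) PE; rewrite /= supp0 // vP0 ?add0r //.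
  by move: ge; clear; lia.
have FP0 : sems F P0 = chi0 by rewrite /P0 (sems_Krev _ okF).
have FP3 : sems F P3 = chi3 by rewrite /P3 (sems_Krev _ okF).
have numhi s : numval Q (inc hi s) = numval Q s.
  by apply: eq_numval => q qQ; case: awhi => _ ->; rewrite // inE mem_cat qQ orbT.
(* A state in block 0 is its own collapse wherever the block bits are clear, and this region is
   stable under the lattice. So the lattice on the shorter register can be computed as the collapse
   of [F]. *)
have colE f eta s : away (p :: Q) f -> clean (z :: ks) eta ->
    (forall s, (W <= numval Q s)%N -> eta s = 0) -> ~~ has s [:: c; c'] ->
    latop ths th p (@incf lo f) eta s = col c c' f (sems F eta) s.
  move=> awf cle supe ns; rewrite sems_lat // (col_latop uQ awf WE) //; last exact: in_block.
  apply: (@latop_eq_on R _ _ _ _ _ _ (fun s => ~~ has s [:: c; c'])) => //.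
  - by move=> u b /=; rewrite !upd_neq // eq_sym.
  - move=> u /=; rewrite /incf; case: awf => _ awf; case: ifP => _;
    by rewrite ?awf ?inc_out // inE mem_cat !inE eqxx !orbT.
  move=> u nu; rewrite /col blockE; last first.
    by move: nu; rewrite /= !negb_or !eqbF_neg andbT.
  rewrite [X in _ + X]supe ?addr0 //; case: (awf) => _ awf2.
  rewrite (@eq_numval _ _ (blk c c' true u)); last first.
    by move=> q qQ; apply: awf2; rewrite inE qQ orbT.
  by rewrite (numval_blk uQ WE); clear; lia.
have awp : away (p :: Q) (inc hi).
  by apply: away_sub awhi => q qQ; rewrite -cat_cons mem_cat qQ.
have final : sems (core ths th p c c' z ks lo A B) psi =
    latop ths th p (inc lo) P0 \+ latop ths th p (inc lo) (P3 \o inc hi).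
  rewrite /core -/Q -/F 3!sems_cat -/phi sems_carry //.
  have -> : (fun s => phi (if s c then inc hi s else s)) = chi0 \+ (chi3 \o inc hi).
    apply/funext => s; rewrite /chi0 /chi3 /= inc_out //.
    by case: ifP => _; rewrite ?addr0 ?add0r.
  rewrite sems_add (@sems_away R (mem (p :: Q ++ z :: ks)) (rev F) (inc hi) chi3
    (p :: Q ++ z :: ks)) ?all_rev // -/P0 -/P3.
  rewrite sems_add !sems_lat //.
  by move=> s h; apply: clP3; rewrite (@eq_in_has _ _ s) // => q qk;
    rewrite inc_out // ; move/hasPn: kh => /(_ q qk).
(* Where a block bit is set both sides are zero: the input is clean there and neither lattice writes
   on these bits. *)
rewrite final; apply/funext => s; have [ns|ns] := boolP (has s [:: c; c']).
  have out f q : away (p :: Q) f -> q \in [:: c; c'] -> forall s, @incf lo f s q = s q.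
    move=> [_ f2] qc u; rewrite /incf; case: ifP => _; rewrite ?f2 ?inc_out //.
    + by move: qc; rewrite !inE => /orP[] /eqP->.
    + by rewrite inE mem_cat qc !orbT.
    by move: qc; rewrite !inE => /orP[] /eqP->.
  have cle f eta : away (p :: Q) f -> (forall s, (W <= numval Q s)%N -> eta s = 0) ->
      latop ths th p (@incf lo f) eta s = 0.
    move=> awf supe; apply: (@clean_latop R [:: c; c']) ns; first by rewrite !inE negb_or pc.
      by move=> u q qc; apply: out.
    move=> u /= h; apply: supe; rewrite numvalQ.
    by move: h W0; clear; case: (u c) (u c') => [] [] //=; lia.
  have incid : inc lo = @incf lo id by apply/funext => u; rewrite /incf if_same.
  rewrite /= incid !cle ?addr0 //; first last.
  - by move=> u le; rewrite /= P3_block ?numhi.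
  rewrite (_ : inc (lo ++ hi) = @incf lo (inc hi)) ?cle //.
  apply/funext => u; rewrite /incf inc_cat //.
  by move: uQ'; rewrite cat_uniq => /andP[].
have incid : inc lo = @incf lo id by apply/funext => u; rewrite /incf if_same.
have incN : inc (lo ++ hi) = @incf lo (inc hi).
  apply/funext => u; rewrite /incf inc_cat //.
  by move: uQ'; rewrite cat_uniq => /andP[].
have clS : clean (z :: ks) (P3 \o inc hi).
  by move=> u h; apply: clP3; rewrite (@eq_in_has _ _ u) // => q qk;
    rewrite inc_out //; move/hasPn: kh => /(_ q qk).
(* The two short lattices are collapses with [f] the identity. They give [chi0] on block 0 and
   [chi3] on block 3 after incrementing the high part; their sum is the collapse of [phi] with [f]
   the high increment. *)
rewrite /= incid !colE //; last by move=> u le; rewrite /= P3_block ?numhi.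
rewrite incN colE // -/phi.
rewrite (@sems_away R _ F (inc hi) P3 (p :: Q ++ z :: ks) okF) // FP0 FP3.
rewrite /col /chi0 /chi3 /= !inc_out // /blk !(upd_eq, upd_neq) //= .
by rewrite !addr0 !add0r.
Qed.

End Core.

(** * Lattice factorization of orthonormal filters *)

Section PlaneRotations.
Local Open Scope ring_scope.

Lemma big_ord_double (V : zmodType) n (F : nat -> V) :
  \sum_(k < n.*2) F k = \sum_(k < n) (F k.*2 + F k.*2.+1).
Proof.
elim: n => [|n IH]; first by rewrite !big_ord0.
by rewrite doubleS !big_ord_recr /= IH addrA.
Qed.

(* A rotation of the plane annihilating the first odd and the last even
   coefficient, which is possible because the extreme coefficient pairs are orthogonal. *)
Lemma orthogonal_rotation (R : rcfType) (a b c d : R) : a * c + b * d = 0 ->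
  exists x y : R, [/\ x ^+ 2 + y ^+ 2 = 1, - y * a + x * b = 0 & x * c + y * d = 0].
Proof.
have main (u v : R) : (u != 0) || (v != 0) ->
    exists r x y : R, [/\ r != 0, x * r = u, y * r = v & x ^+ 2 + y ^+ 2 = 1].
  move=> nz; pose r := Num.sqrt (u ^+ 2 + v ^+ 2).
  have pos : 0 < u ^+ 2 + v ^+ 2.
    by rewrite lt0r addr_ge0 ?sqr_ge0 // paddr_eq0 ?sqr_ge0 // !sqrf_eq0 negb_and nz.
  have r0 : r != 0 by rewrite sqrtr_eq0 -ltNge.
  exists r, (u / r), (v / r); rewrite !divfK // !expr_div_n -mulrDl.
  by rewrite sqr_sqrtr ?ltW // divff // gt_eqF.
have [ab|ab] := boolP ((a != 0) || (b != 0)).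
  have [r [x [y [r0 xa yb xy]]]] := main a b ab => orth; exists x, y; split=> //.
    by rewrite -xa -yb; ring.
  by apply: (mulfI r0); rewrite mulr0 -orth -xa -yb; ring.
move: ab; rewrite negb_or !negbK => /andP[/eqP-> /eqP->] _.
have [cd|cd] := boolP ((d != 0) || (- c != 0)).
  have [r [x [y [r0 xd yc xy]]]] := main d (- c) cd; exists x, y; split=> //.
    by ring.
  by rewrite -xd -[c]opprK -yc; ring.
move: cd; rewrite negb_or !negbK oppr_eq0 => /andP[/eqP-> /eqP->].
by exists 1, 0; split; ring.
Qed.

(** The rotation preserves each scalar product. Advancing the second coordinate by one index loses
    only its term at 0 and the term of the first coordinate at [L.+1], and both are annihilated. It
    serves for the orthonormality of the shortened filter and for the amplitudes alike. *)
Lemma rotated_sum (A : comRingType) (x y : A) (u v U V : nat -> A) L :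
  x ^+ 2 + y ^+ 2 = 1 -> - y * u 0%N + x * v 0%N = 0 -> x * u L.+1 + y * v L.+1 = 0 ->
  \sum_(k < L.+1) ((x * u k + y * v k) * (x * U k + y * V k) +
    (- y * u k.+1 + x * v k.+1) * (- y * U k.+1 + x * V k.+1)) =
  \sum_(k < L.+2) (u k * U k + v k * V k).
Proof.
move=> xy h0 hL.
have e k : u k * U k + v k * V k = (x * u k + y * v k) * (x * U k + y * V k) +
    (- y * u k + x * v k) * (- y * U k + x * V k).
  by rewrite -[LHS]mul1r -xy; ring.
under [in RHS]eq_bigr => k _ do rewrite e.
rewrite !big_split /= [in RHS]big_ord_recr /= hL mul0r addr0.
by rewrite [X in _ = _ + X]big_ord_recl /= h0 mul0r add0r.
Qed.

End PlaneRotations.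

Section FilterLattice.
Variable R : realType.
Local Notation C := (R[i]).
Local Open Scope ring_scope.

(* The paraunitary polyphase matrix [[e o] [o~ -e~]] factors into rotations and
   unit delays; one rotation and one delay are split off per step. *)
Lemma polyphase_lattice L (e o : nat -> R) :
  (forall k, (L < k)%N -> e k = 0 /\ o k = 0) ->
  (forall m, \sum_(k < L.+1) (e k * e (k + m)%N + o k * o (k + m)%N) = (m == 0%N)%:R) ->
  exists ths th, [/\ size ths = L, all (@unit_pair R) (th :: ths) &
    forall p f psi s, away [:: p] f ->
    latop ths th p f psi s = \sum_(k < L.+1)
      (((if s p then o (L - k)%N else e k)%:C)%C * psi (upd (iter k f s) p false) +
       ((if s p then - e (L - k)%N else o k)%:C)%C * psi (upd (iter k f s) p true))].
Proof.
elim: L e o => [|L IH] e o supp orth.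
  exists [::], (e 0%N, o 0%N); split=> //.
    rewrite /= /unit_pair /= andbT; move: (orth 0%N).
    by rewrite big_ord1 /= -!expr2 => ->.
  move=> p f psi s _; rewrite big_ord1 /= /refl subn0.
  by case: ifP => _ //; rewrite rmorphN mulNr.
have [eL1 oL1] : (forall k, e (L.+2 + k)%N = 0) /\ (forall k, o (L.+2 + k)%N = 0).
  by split=> k; case: (supp (L.+2 + k)%N) => //; lia.
(* In the relation for the largest shift [L.+1] only the term at 0 survives. *)
have /orthogonal_rotation[x [y [xy h0 hL]]] : e 0%N * e L.+1 + o 0%N * o L.+1 = 0.
  have := orth L.+1; rewrite big_ord_recl big1 ?addr0 //= => i _.
  have -> : (bump 0 i + L.+1 = L.+2 + i)%N by rewrite /bump; lia.
  by rewrite eL1 oL1 !mulr0 addr0.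
pose e' k := x * e k + y * o k; pose o' k := - y * e k.+1 + x * o k.+1.
have [||ths [th [sz un IHf]]] := IH e' o'.
- move=> k lt; rewrite /e' /o'; have [-> ->] := supp k.+1 lt.
  rewrite !mulr0 addr0; split=> //; move: lt; rewrite leq_eqVlt => /orP[/eqP<- //|lt].
  by have [-> ->] := supp k lt; rewrite !mulr0 addr0.
- by move=> m; rewrite -orth -(rotated_sum (fun k => e (k + m)%N) (fun k => o (k + m)%N) xy h0 hL).
exists ((x, y) :: ths), th; split=> /=; first by rewrite sz.
  by move: un => /= /andP[-> ->]; rewrite /unit_pair /= xy eqxx.
move=> p f psi s awf; rewrite IHf //; case: (awf) => f1 f2.
set z := cond _ _ _.
have [ze zo] : (forall t, z (upd t p false) = (x%:C)%C * psi (upd t p false) +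
      (y%:C)%C * psi (upd t p true)) /\
    (forall t, z (upd t p true) = - (y%:C)%C * psi (upd (f t) p false) +
      (x%:C)%C * psi (upd (f t) p true)).
  split=> t; rewrite /z /cond /= /refl !upd_eq ?f1 ?mem_head // ?upd_eq !upd_upd ?upd_eq.
    by rewrite rmorph1 rmorph0 ?upd_upd; ring.
  by rewrite rmorph1 rmorph0 ?upd_upd; ring.
(* The high-pass row is the low-pass row reversed and turned by a right angle, so it meets the same
   two boundary conditions with their roles exchanged. *)
pose u k := if s p then o (L.+1 - k)%N else e k.
pose v k := if s p then - e (L.+1 - k)%N else o k.
rewrite -(@rotated_sum C (x%:C)%C (y%:C)%C (fun k => ((u k)%:C)%C) (fun k => ((v k)%:C)%C)
  (fun k => psi (upd (iter k f s) p false)) (fun k => psi (upd (iter k f s) p true))).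
- apply: eq_bigr => -[k /= kL] _; rewrite ze zo -!(rmorphM, rmorphN, rmorphD).
  congr ((_%:C)%C * _ + (_%:C)%C * _); rewrite /u /v /e' /o' ?subSS; case: ifP => _ //.
    by rewrite subSn //; ring.
  by ring.
- by rewrite -!rmorphXn -rmorphD xy rmorph1.
- rewrite -!(rmorphM, rmorphN, rmorphD) /u /v !subn0; case: ifP => _; last by rewrite h0.
  have -> : - y * o L.+1 + x * - e L.+1 = - (x * e L.+1 + y * o L.+1) by ring.
  by rewrite hL oppr0 rmorph0.
rewrite -!(rmorphM, rmorphN, rmorphD) /u /v subnn; case: ifP => _; last by rewrite hL.
have -> : x * o 0%N + y * - e 0%N = - y * e 0%N + x * o 0%N by ring.
by rewrite h0 rmorph0.
Qed.

(** Even and odd coefficients form the two polyphase components. The reversal and alternating sign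
    in [hipass] become exactly the second row of the polyphase matrix. *)
Lemma filter_lattice L (h : nat -> R) : wavelet_filter L.+1.*2 h ->
  exists ths th, [/\ size ths = L, all (@unit_pair R) (th :: ths) &
    forall p f psi s, away [:: p] f ->
    latop ths th p f psi s = \sum_(k < L.+1.*2)
      ((if s p then hipass L.+1.*2 h k else h k)%:C)%C * psi (upd (iter k./2 f s) p (odd k))].
Proof.
move=> [supp [_ orth]].
have [||ths [th [sz un lf]]] := @polyphase_lattice L (fun k => h k.*2) (fun k => h k.*2.+1).
- by move=> k lt; split; apply: supp; lia.
- move=> m; rewrite -orth (big_ord_double _ (fun k => h k * h (k + 2 * m)%N)).
  apply: eq_bigr => k _; congr (h _ * h _ + h _ * h _); lia.
exists ths, th; split=> // p f psi s awf; rewrite lf //.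
rewrite (big_ord_double _ (fun k => ((if s p then hipass _ h k else h k)%:C)%C *
  psi (upd (iter k./2 f s) p (odd k)))).
apply: eq_bigr => -[k /= kL] _; rewrite doubleK uphalf_double odd_double /=.
congr ((_%:C)%C * _ + (_%:C)%C * _); rewrite /hipass; case: ifP => _ //.
  rewrite ifT; last by lia.
  rewrite -signr_odd odd_double expr0 mul1r; congr h; lia.
rewrite ifT; last by lia.
rewrite -signr_odd /= odd_double /= expr1 mulN1r; congr (- h _); lia.
Qed.

End FilterLattice.

(** * Matrices of circuits *)

Definition bits (x : nat) : nat -> bool := fun q => bit q x.

Lemma bit0 x : bit 0 x = odd x.
Proof. by rewrite /bit expn0 divn1. Qed.

Lemma bitS q x : bit q.+1 x = bit q x./2.
Proof. by rewrite /bit expnS divnMA divn2. Qed.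

Lemma bit_numval a m s j :
  bit j (numval (iota a m) s) = (j < m) && s (a + j).
Proof.
elim: m a j => [|m IH] a j /=; first by rewrite /bit div0n.
case: j => [|j].
  by rewrite bit0 oddD odd_double addbF addn0; case: (s a).
by rewrite bitS half_bit_double IH addSnnS ltnS.
Qed.

Lemma modn_double (b : bool) y h : 0 < h -> (b + y.*2) %% h.*2 = b + (y %% h).*2.
Proof.
move=> h0; have lt : y %% h < h by rewrite ltn_mod.
have -> : b + y.*2 = y %/ h * h.*2 + (b + (y %% h).*2).
  by rewrite {1}(divn_eq y h) -!muln2 mulnDl mulnA addnCA.
rewrite modnMDl modn_small //.
by move: (y %% h) lt; clear; case: b => /=; lia.
Qed.

Lemma numval_bits a m x : numval (iota a m) (bits x) = x %/ 2 ^ a %% 2 ^ m.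
Proof.
elim: m a => [|m IH] a /=; first by rewrite modn1.
rewrite IH /bits /bit expnSr divnMA divn2 expnS mul2n -modn_double ?expn_gt0 //.
by rewrite odd_double_half.
Qed.

Lemma bit_out k x q : x < 2 ^ k -> k <= q -> bit q x = false.
Proof.
move=> lt le; rewrite /bit divn_small //.
by apply: leq_trans lt _; rewrite leq_exp2l.
Qed.

Lemma bits_numval k s : (forall q, k <= q -> s q = false) ->
  bits (numval (iota 0 k) s) = s.
Proof.
move=> out; apply/funext => q; rewrite /bits bit_numval add0n.
by case: ltnP => //= /out ->.
Qed.

Lemma local_idxE qs x : local_idx qs x = numval qs (bits x).
Proof.
rewrite /local_idx; elim: qs => [|q qs IH] /=; first by rewrite big_ord0.
rewrite big_ord_recl /= muln1; congr (_ + _).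
rewrite -IH -mul2n big_distrr /=; apply: eq_bigr => i _.
by rewrite /bump /= expnS mulnCA.
Qed.

Fixpoint setl (qs : seq nat) (j : nat) (s : nat -> bool) : nat -> bool :=
  if qs is q :: qs' then upd (setl qs' j./2 s) q (odd j) else s.

Lemma setl_out qs j s q : q \notin qs -> setl qs j s q = s q.
Proof.
elim: qs j => //= r qs IH j; rewrite inE negb_or => /andP[qr nq].
by rewrite upd_neq // IH.
Qed.

Lemma numval_setl qs j s : uniq qs -> j < 2 ^ size qs -> numval qs (setl qs j s) = j.
Proof.
elim: qs j => [|q qs IH] j /=; first by case: j.
move=> /andP[nq uq] lt; rewrite upd_eq numval_upd // IH ?odd_double_half //.
rewrite expnS mul2n in lt; rewrite -ltn_double; apply: leq_ltn_trans lt.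
by rewrite -{2}(odd_double_half j) leq_addl.
Qed.

Lemma setl_numval qs s t : (forall q, q \notin qs -> t q = s q) ->
  setl qs (numval qs t) s = t.
Proof.
move=> out; apply/funext => q; have [nq|nq] := boolP (q \in qs); last first.
  by rewrite setl_out // out.
elim: qs nq {out} => //= r qs IH; rewrite inE /upd => /orP[/eqP->|nq].
  by rewrite eqxx oddD odd_double addbF; case: (t r).
case: eqP => [->|_]; first by rewrite oddD odd_double addbF; case: (t r).
by rewrite half_bit_double IH.
Qed.

Section Embedding.
Variable R : realType.
Local Notation C := (R[i]).
Local Open Scope ring_scope.

Definition vec (k : nat) (psi : (nat -> bool) -> C) : 'cV[C]_(2 ^ k) :=
  \col_(x < 2 ^ k) psi (bits x).

(** In row [x] only the columns agreeing with [x] off [qs] contribute; they are parametrized by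
    their local index on [qs]. *)
Lemma embed_vec k qs (f : nat -> nat -> C) psi : uniq qs -> all (ltn^~ k) qs ->
  embed k qs f *m vec k psi = vec k (fun s =>
    \sum_(j < 2 ^ size qs) f (numval qs s) j * psi (setl qs j s)).
Proof.
move=> uq ltk; apply/matrixP => x i; rewrite !mxE.
under eq_bigr => y _ do rewrite !mxE !local_idxE.
have enc_lt s : (numval (iota 0 k) s < 2 ^ k)%N.
  by have := numval_lt (iota 0 k) s; rewrite size_iota.
pose put (j : 'I_(2 ^ size qs)) : 'I_(2 ^ k) := Ordinal (enc_lt (setl qs j (bits x))).
pose get (y : 'I_(2 ^ k)) : 'I_(2 ^ size qs) := Ordinal (numval_lt qs (bits y)).
pose P (y : 'I_(2 ^ k)) := [forall q : 'I_k, (val q \notin qs) ==> (bit q x == bit q y)].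
have putE j : bits (put j) = setl qs j (bits x).
  rewrite /put /= bits_numval // => q kq; rewrite setl_out; last first.
    by apply: contraL kq => /(allP ltk) /=; rewrite ltnNge.
  exact: bit_out (ltn_ord x) kq.
have getK y : P y -> put (get y) = y.
  move=> /forallP Py; apply/val_inj => /=; rewrite (setl_numval (t := bits y)).
    by rewrite numval_bits expn0 divn1 modn_small.
  move=> q nq; have [lt|ge] := ltnP q k.
    by have /implyP/(_ nq)/eqP := Py (Ordinal lt).
  by rewrite /bits !(bit_out (ltn_ord _) ge).
transitivity (\sum_(y | P y) f (numval qs (bits x)) (numval qs (bits y)) * psi (bits y)).
  rewrite [RHS]big_mkcond; apply: eq_bigr => y _; rewrite -/(P y).
  by case: ifP => _; rewrite ?mul0r.
rewrite (reindex_onto put get) //=; apply: eq_big => [j|j _]; last first.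
  by rewrite putE numval_setl.
have -> : get (put j) == j by apply/eqP/val_inj; rewrite /= [bits _]putE numval_setl.
rewrite andbT; apply/forallP => q; apply/implyP => nq.
by rewrite -[bit q (put j)]/(bits (put j) q) putE setl_out.
Qed.

Lemma mxnatE m n (E : nat -> nat -> C) i j : (i < m)%N -> (j < n)%N ->
  mxnat (\matrix_(i < m, j < n) E i j) i j = E i j.
Proof. by move=> im jn; rewrite /mxnat !insubT /= mxE. Qed.

Definition cnot_perm (j : nat) : nat :=
  if j == 1%N then 3%N else if j == 3%N then 1%N else j.

Definition refl_entry (x y : R) (i j : nat) : R :=
  if i == 0%N then if j == 0%N then x else y else if j == 0%N then y else - x.

Definition gate_mx (k : nat) (g : gate R) : 'M[C]_(2 ^ k) :=
  match g with
  | Cnot c t => embed k [:: c; t]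
      (mxnat (\matrix_(i < 4, j < 4) ((val i == cnot_perm j)%:R : C)))
  | Tof c1 c2 t => embed k [:: c1; c2; t] (mxnat (toffoli_mx R))
  | Refl q x y => embed k [:: q]
      (mxnat (\matrix_(i < 2, j < 2) ((refl_entry x y i j)%:C)%C))
  end.

Lemma gate_mxP k g : gate_ok (ltn^~ k) g -> is_gate (gate_mx k g).
Proof.
case: g => [c t|c1 c2 t|q x y] /and3P[/= u].
- move=> /and3P[ck tk _] _; right; left; exists c, t, (\matrix_(i, j) (val i == cnot_perm j)%:R).
  split=> //; split=> //; split; first by move: u; rewrite inE andbT.
  split=> //; apply/matrixP => i j; rewrite !mxE.
  under eq_bigr => l _ do rewrite !mxE rmorph_nat -natrM mulnb.
  by rewrite !big_ord_recl big_ord0; case: i j => [[|[|[|[|?]]]]] // ? [[|[|[|[|?]]]]] //= ?;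
     rewrite ?addr0 ?add0r.
- move=> /and4P[ck1 ck2 tk _] _; right; right; exists c1, c2, t.
  by do 4!split=> //.
move=> /andP[qk _] /eqP xy; left; exists q, (\matrix_(i, j) ((refl_entry x y i j)%:C)%C).
split=> //; split=> //; apply/matrixP => i j; rewrite !mxE.
under eq_bigr => l _ do rewrite !mxE.
have conjR (a : R) : ((a%:C)%C)^* = (a%:C)%C by exact: conjc_real.
rewrite !big_ord_recl big_ord0 /= !conjR -!rmorphM -!rmorphD addr0.
by case: i j => [[|[|?]]] // ? [[|[|?]]] //= ?; rewrite /refl_entry /= -[RHS](rmorph_nat (real_complex R));
  congr (real_complex R); rewrite -?xy; ring.
Qed.

Lemma sum_perm n (pi : nat -> nat) (F : nat -> C) i : (i < n)%N ->
  (forall j, (j < n)%N -> (pi j < n)%N /\ pi (pi j) = j) ->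
  \sum_(j < n) (i == pi j)%:R * F j = F (pi i).
Proof.
move=> lt piK; have [plt pK] := piK i lt.
rewrite (bigD1 (Ordinal plt)) //= pK eqxx mul1r big1 ?addr0 // => j ne.
case: eqP => [e|_]; last by rewrite mul0r.
by case/eqP: ne; apply: val_inj; rewrite /= e; case: (piK j (ltn_ord j)).
Qed.

Lemma gate_mx_vec k g psi : gate_ok (ltn^~ k) g ->
  gate_mx k g *m vec k psi = vec k (sem g psi).
Proof.
case: g => [c t|c1 c2 t|q x y] /and3P[u ltk _]; rewrite /gate_mx embed_vec //;
  congr vec; apply/funext => s.
- have lt := numval_lt [:: c; t] s.
  under eq_bigr => j _ do rewrite (mxnatE (fun i j => (i == cnot_perm j)%:R)) //.
  rewrite (@sum_perm 4 cnot_perm (fun j => psi (setl [:: c; t] j s))) //; last first.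
    by case=> [|[|[|[|]]]].
  congr psi; rewrite -[RHS](@setl_numval [:: c; t] s); last first.
    by move=> q; rewrite /= !inE negb_or => /andP[_ qt]; rewrite upd_neq.
  congr setl; move: u; rewrite /= inE andbT => ct.
  by rewrite upd_neq // upd_eq; case: (s c) (s t) => [] [].
- have lt := numval_lt [:: c1; c2; t] s.
  under eq_bigr => j _ do rewrite (mxnatE (fun i j => (i == toffoli_perm j)%:R)) //.
  rewrite (@sum_perm 8 toffoli_perm (fun j => psi (setl [:: c1; c2; t] j s))) //; last first.
    by case=> [|[|[|[|[|[|[|[|]]]]]]]].
  congr psi; rewrite -[RHS](@setl_numval [:: c1; c2; t] s); last first.
    by move=> q; rewrite /= !inE !negb_or => /and3P[_ _ qt]; rewrite upd_neq.
  congr setl; move: u; rewrite /= !inE !negb_or => /and3P[/andP[_ ct] ct' _].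
  by rewrite upd_eq !upd_neq //; case: (s c1) (s c2) (s t) => [] [] [].
have lt := numval_lt [:: q] s.
under eq_bigr => j _ do rewrite (mxnatE (fun i j => ((refl_entry x y i j)%:C)%C)) //.
rewrite !big_ord_recl big_ord0 /= addr0 addn0 /refl /refl_entry.
by case: (s q) => //=; rewrite rmorphN mulNr.
Qed.

Definition circuit_of (k : nat) (c : seq (gate R)) : seq 'M[C]_(2 ^ k) :=
  map (gate_mx k) c.

Lemma circuit_of_gates k c : all (gate_ok (ltn^~ k)) c -> all_gates k (circuit_of k c).
Proof.
elim: c => //= g c IH /andP[og oc] G; rewrite inE => /orP[/eqP->|]; last exact: IH.
exact: gate_mxP.
Qed.

Lemma circuit_of_vec k c psi : all (gate_ok (ltn^~ k)) c ->
  circuit_mx (circuit_of k c) *m vec k psi = vec k (sems c psi).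
Proof.
rewrite /circuit_mx.
suff gen A phi : A *m vec k psi = vec k phi -> all (gate_ok (ltn^~ k)) c ->
    foldl (fun acc g => g *m acc) A (circuit_of k c) *m vec k psi = vec k (sems c phi).
  by apply: gen; rewrite mul1mx.
elim: c A phi => //= g c IH A phi e /andP[og oc].
by apply: IH => //; rewrite -mulmxA e gate_mx_vec.
Qed.

End Embedding.

(** * The packet transform *)

Lemma numval_iter_inc qs k s : uniq qs ->
  numval qs (iter k (inc qs) s) = (numval qs s + k) %% 2 ^ size qs.
Proof.
move=> u; elim: k => [|k IH]; first by rewrite addn0 modn_small // numval_lt.
rewrite iterS numval_inc // IH addnS; set y := numval qs s + k.
have := ltn_mod y (2 ^ size qs); rewrite expn_gt0 /= => lt.
rewrite -(addn1 y) -modnDml addn1; case: eqP => [->|ne]; first by rewrite modnn.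
by rewrite [RHS]modn_small // ltn_neqAle lt andbT; apply/eqP.
Qed.

Lemma numval_inj qs s t : numval qs s = numval qs t -> {in qs, s =1 t}.
Proof.
elim: qs => //= q qs IH e; have /IH h : numval qs s = numval qs t.
  by move: (congr1 half e); rewrite !half_bit_double.
move=> r; rewrite inE => /orP[/eqP->|/h //].
by move: (congr1 odd e); rewrite !oddD !odd_double !addbF; case: (s q) (t q) => [] [].
Qed.

Lemma numval_zero qs s : ~~ has s qs -> numval qs s = 0.
Proof. by elim: qs => //= q qs IH; rewrite negb_or => /andP[/negbTE-> /IH->]. Qed.

Lemma bit_shift q a x : bit q (x * 2 ^ a) = (a <= q) && bit (q - a) x.
Proof.
elim: a q => [|a IH] q; first by rewrite expn0 muln1 subn0.
rewrite expnSr mulnA muln2; case: q => [|q]; first by rewrite bit0 odd_double.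
by rewrite bitS doubleK IH ltnS subSS.
Qed.

Lemma last_iota a k : last a (iota a.+1 k) = a + k.
Proof. by elim: k a => [|k IH] a /=; rewrite ?addn0 // IH addSnnS. Qed.

Lemma belast_iota a k : belast a (iota a.+1 k) = iota a k.
Proof. by elim: k a => //= k IH a; rewrite IH. Qed.

Lemma bit_high m r x y : m <= r -> x %/ 2 ^ m = y %/ 2 ^ m -> bit r x = bit r y.
Proof. by move=> le e; rewrite /bit -(subnKC le) expnD !divnMA e. Qed.

Lemma iter_inc_out qs k s q : q \notin qs -> iter k (inc qs) s q = s q.
Proof. by move=> nq; elim: k => //= k IH; rewrite inc_out. Qed.

Lemma modn_half x h : 0 < h -> x %% h.*2 = odd (x %/ h) * h + x %% h.
Proof.
move=> h0; have lt : x %% h < h by rewrite ltn_mod.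
have {1}-> : x = (x %/ h)./2 * h.*2 + (odd (x %/ h) * h + x %% h).
  rewrite {1}(divn_eq x h) -{1}(odd_double_half (x %/ h)) -!muln2 mulnDl addnA.
  by congr (_ + _); rewrite addnC mulnAC mulnA.
rewrite modnMDl modn_small //.
by move: (x %% h) lt; clear; case: (odd _) => /=; lia.
Qed.

Lemma modn_unshift c k N : c < N -> k < N -> ((c + k) %% N + N - c) %% N = k.
Proof.
move=> cN kN; have [lt|ge] := ltnP (c + k) N.
  rewrite (modn_small lt) (_ : c + k + N - c = k + N); last by lia.
  by rewrite modnDr modn_small.
have -> : (c + k) %% N = c + k - N.
  by rewrite -{1}(subnK ge) modnDr modn_small //; lia.
by rewrite (_ : c + k - N + N - c = k) ?modn_small //; lia.
Qed.

(** * The perfect shuffle as a cyclic shift of qubits *)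

Section Rotation.
Variable R : realType.

Definition swapc (p q : nat) : seq (gate R) := [:: Cnot R p q; Cnot R q p; Cnot R p q].

(** A chain of swaps; on configurations [p] receives the top bit and every other position its lower
    neighbour. On states this moves the parity qubit to the top, separating low-pass from high-pass
    outputs. *)
Fixpoint rotc (p : nat) (qs : seq nat) : seq (gate R) :=
  if qs is q :: qs' then swapc p q ++ rotc q qs' else [::].

Lemma rotc_classical p qs : all (@classical R) (rotc p qs).
Proof. by elim: qs p => //= q qs IH p; rewrite IH. Qed.

Lemma size_rotc p qs : size (rotc p qs) = 3 * size qs.
Proof. by elim: qs p => //= q qs IH p; rewrite IH; lia. Qed.

Lemma rotc_ok P p qs : uniq (p :: qs) -> all P (p :: qs) -> all (gate_ok P) (rotc p qs).
Proof.
elim: qs p => // q qs IH p; rewrite cons_uniq inE negb_or => /andP[/andP[pq _] u].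
move=> /andP[Pp Pq]; rewrite /= IH // /gate_ok /= !inE pq (eq_sym q) pq Pp.
by case/andP: Pq => ->.
Qed.

Lemma pull_swapc p q s : p != q ->
  pull (swapc p q) s = upd (upd s q (s p)) p (s q).
Proof.
move=> pq; have qp : q != p by rewrite eq_sym.
rewrite /= !(upd_eq, upd_neq) //; apply/funext => r; rewrite /upd.
have [->|_] := eqVneq r q; first by rewrite (negbTE qp); case: (s p) (s q) => [] [].
by have [_|//] := eqVneq r p; case: (s p) (s q) => [] [].
Qed.

Lemma pull_rotc p qs s : uniq (p :: qs) ->
  [/\ pull (rotc p qs) s p = s (last p qs),
      numval qs (pull (rotc p qs) s) = numval (belast p qs) s &
      forall q, q \notin p :: qs -> pull (rotc p qs) s q = s q].
Proof.
elim: qs p => [//|q qs IH] p; rewrite cons_uniq inE negb_or => /andP[/andP[pq pn] u].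
have [e1 e2 e3] := IH q u; rewrite -[rotc _ _]/(swapc p q ++ rotc q qs) pull_cat pull_swapc //.
have qn : q \notin qs by case/andP: u.
have qp : q != p by rewrite eq_sym.
set t := pull _ s in e1 e2 e3 *; split; first by rewrite upd_eq e1.
  rewrite /= upd_neq // upd_eq !numval_upd // e2 e3 //.
  by rewrite inE negb_or pq.
move=> r; rewrite !inE !negb_or => /and3P[rp rq rn].
by rewrite !upd_neq // e3 // inE negb_or rq.
Qed.

End Rotation.

(** * One level, the whole packet transform, and the gate count *)

Section Level.
Variable R : realType.
Local Notation C := (R[i]).
Local Open Scope ring_scope.

(* The circuit before the perfect shuffle: a single reflection when [L = 0],
   and otherwise the carry construction on [up_log 2 M - 1] low-order qubits. *)
Lemma lattice_circuit L m n (ths : seq (R * R)) th :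
  let M := L.+1.*2 in let a := (up_log 2 M + 1)%N in
  (M <= 2 ^ m)%N -> (m <= n)%N -> size ths = L -> all (@unit_pair R) (th :: ths) ->
  exists gs : seq (gate R), [/\ all (gate_ok (ltn^~ (n + a)%N)) gs,
    (size gs <= 50 * m + 24 * (up_log 2 M * M))%N &
    forall psi, clean (iota 0 a) psi ->
      sems gs psi = latop ths th a (inc (iota a.+1 m.-1)) psi].
Proof.
move=> M a Mm mn sz un; have m0 : (0 < m)%N by case: (m) Mm => //; rewrite /M; lia.
have u0 : (0 < up_log 2 M)%N by rewrite up_log_gt0 /M; lia.
case: L => [|L] in M a Mm sz u0 *.
  exists [:: Refl a th.1 th.2]; case: ths sz un => //= _ un; split=> //; last by rewrite /M; lia.
  rewrite /gate_ok /= !andbT; move: un; rewrite andbT => un.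
  by apply/andP; split; [lia|exact: un].
have u1 : (1 < up_log 2 M)%N.
  by rewrite -[2%N](@up_expnK 2 2) // leq_up_log // /M; lia.
(* The least width with M/2 at most [2 ^ w], so that all delays stay within one block. *)
pose w := (up_log 2 M).-1; have uw : up_log 2 M = w.+1 by rewrite prednK.
have w0 : (0 < w)%N by rewrite -ltnS -uw.
have aw : a = w.+2 by rewrite /a uw addn1.
have wm : (w < m)%N by rewrite -uw; apply: up_log_min.
have LW : (L.+2 <= 2 ^ w)%N.
  have := up_logP M (isT : (1 < 2)%N); rewrite uw expnS /M -mul2n.
  by rewrite leq_pmul2l.
(* The halves differ in length by at most one and [lo] is nonempty, so each half together with [lo]
   is long enough to be borrowed by the other, even with the extra carry bit of [A]. *)
pose r := (m.-1 - w)%N; pose r1 := r./2.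
pose lo := iota a.+1 w; pose A := iota (a.+1 + w) r1; pose B := iota (a.+1 + w + r1) (r - r1).
have r1r : (r1 <= r)%N by rewrite /r1; lia.
have hiE : A ++ B = iota (a.+1 + w) r by rewrite /A /B -iotaD subnKC.
have loE : lo ++ A ++ B = iota a.+1 m.-1.
  by rewrite hiE /lo -iotaD; congr iota; rewrite /r; lia.
(* The ancillas are used up exactly: two block bits, and [w] clean bits, just enough for a ripple
   over [w + 2] bits. *)
have ancE : [:: 0%N, 1%N, 2%N & iota 3 w.-1] = iota 0 a by rewrite aw -(prednK w0).
have allE : (a :: lo ++ (A ++ B) ++ [:: 0%N, 1%N, 2%N & iota 3 w.-1]) = iota a m ++ iota 0 a.
  by rewrite ancE catA loE -cat_cons -(prednK m0).
have uni : uniq (a :: lo ++ (A ++ B) ++ [:: 0%N, 1%N, 2%N & iota 3 w.-1]).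
  by rewrite allE uniq_catC -[X in iota X m]add0n -iotaD iota_uniq.
exists (core ths th a 0 1 2 (iota 3 w.-1) lo A B); split.
- apply: core_ok => //; rewrite allE all_cat; apply/andP; split; apply/allP => q;
  rewrite mem_iota => /andP[_ lt]; rewrite /=; lia.
- apply: leq_trans; first exact: size_core.
  rewrite !size_iota sz uw /M.
  have : (r1 + (r - r1) < m)%N by rewrite subnKC // /r; lia.
  by move: (r1 + _)%N => t lt; nia.
move=> psi cl; rewrite -loE; have := sems_core uni un (erefl _); rewrite !size_iota; apply.
- by rewrite prednK.
- by rewrite /r1; lia.
- by rewrite /r1; lia.
- by rewrite sz; lia.
by rewrite ancE.
Qed.

(** The top bit [b] of a row index within its block selects the filter, the rest is the position
    [t]. The qubit rotation brings [b] to the parity position, where the lattice expects it. *)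
Lemma level_circuit L n l (h : nat -> R) :
  let M := L.+1.*2 in let a := (up_log 2 M + 1)%N in
  wavelet_filter M h -> (l < n)%N -> (M <= 2 ^ (n - l))%N ->
  exists gs : seq (gate R), [/\ all (gate_ok (ltn^~ (n + a)%N)) gs,
    (size gs <= 60 * (n - l) + 24 * (up_log 2 M * M))%N &
    forall psi, clean (iota 0 a) psi -> clean (iota 0 a) (sems gs psi) /\
      \col_(x < 2 ^ n) sems gs psi (bits (x * 2 ^ a)) =
      packet_level M n h l *m \col_(x < 2 ^ n) psi (bits (x * 2 ^ a))].
Proof.
move=> M a wf ln; set m := (n - l)%N => MN.
have [ths [th [sz un lf]]] := filter_lattice wf.
have [gs [ok szg gsE]] := lattice_circuit MN (leq_subr l n) sz un.
have m0 : (0 < m)%N by rewrite subn_gt0.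
pose qs := iota a.+1 m.-1.
have pqs : a :: qs = iota a m by rewrite /qs -{2}(prednK m0).
have upq : uniq (a :: qs) by rewrite pqs iota_uniq.
have uq : uniq qs by case/andP: upq.
have aq : a \notin qs by case/andP: upq.
have mn : (m <= n)%N by rewrite leq_subr.
exists (gs ++ rotc R a qs); split.
- rewrite all_cat ok rotc_ok //; apply/allP => q; rewrite pqs mem_iota => /andP[_ lt] /=; lia.
- rewrite size_cat size_rotc size_iota; move: szg; rewrite -/M; lia.
move=> psi cl; rewrite sems_cat gsE // -/qs sems_classical ?rotc_classical //.
have awq : away [:: a] (inc qs) by apply: away_inc; rewrite /= orbF.
split=> [s /hasP[q qa sq]|].
  apply: (@clean_latop _ (iota 0 a)) => //; first by rewrite mem_iota ltnn andbF.
    by move=> t r ra; apply: inc_out; move: ra; rewrite /qs !mem_iota; lia.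
  apply/hasP; exists q => //; have [_ _ ->] := pull_rotc R s upq => //.
  by rewrite pqs; move: qa; rewrite !mem_iota; lia.
set N := (2 ^ m)%N in MN *; pose half := (2 ^ m.-1)%N.
have NE : N = half.*2 by rewrite /N -(prednK m0) expnS mul2n.
have half0 : (0 < half)%N by rewrite expn_gt0.
have N0 : (0 < N)%N by rewrite expn_gt0.
have Nn : (2 ^ n = 2 ^ l * N)%N by rewrite /N -expnD subnKC // ltnW.
apply/matrixP => x zz; rewrite !mxE /= lf //.
have [] := pull_rotc R (bits (x * 2 ^ a)) upq; set s := pull _ _.
rewrite /qs last_iota belast_iota -/qs numval_bits mulnK ?expn_gt0 // -/half.
set t := (x %% half)%N; set b := bits _ _ => sa sq sout.
have xN : (x %% N = b * half + t)%N.
  by rewrite NE modn_half // /b /bits bit_shift leq_addr addKn.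
have th' : (t < half)%N by rewrite ltn_mod.
have tN : (t.*2 < N)%N by rewrite NE ltn_double.
(* The column met by the coefficient of index [k]: [k./2] delays from [t] together with parity
   [odd k] give [t.*2 + k] modulo [N]. *)
pose y k := (x %/ N * N + (t.*2 + k) %% N)%N.
have ydiv k : (y k %/ N = x %/ N)%N.
  by rewrite /y divnMDl // [X in (_ + X)%N]divn_small ?ltn_mod // addn0.
have ymod k : (y k %% N = (t.*2 + k) %% N)%N by rewrite /y modnMDl modn_mod.
have yN k : (y k < 2 ^ n)%N.
  by rewrite Nn -ltn_divLR // ydiv ltn_divLR // -Nn.
have yE k : upd (iter k./2 (inc qs) s) a (odd k) = bits (y k * 2 ^ a).
  apply/funext => q; have [qin|qout] := boolP (q \in a :: qs).
    apply: numval_inj qin; rewrite {2}pqs numval_bits mulnK ?expn_gt0 // -/N ymod.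
    rewrite /= upd_eq numval_upd // numval_iter_inc // sq size_iota -/half.
    by rewrite NE -modn_double // doubleD addnCA odd_double_half.
  have qs' : q \notin qs by move: qout; rewrite inE negb_or => /andP[].
  rewrite upd_neq; last by move: qout; rewrite inE negb_or => /andP[].
  rewrite iter_inc_out // sout // /bits !bit_shift; case: leqP => //= aq'.
  apply: (@bit_high m); last by rewrite -/N ydiv.
  by move: qout; rewrite pqs mem_iota aq' /= -leqNgt; lia.
pose f k := if b then hipass M h k else h k.
have fout k : (M <= k)%N -> f k = 0.
  move=> le; rewrite /f /hipass ltnNge le /=.
  by case: ifP => // _; case: wf => ->.
transitivity (\sum_(k < M) ((f k)%:C)%C * psi (bits (y k * 2 ^ a))).
  by apply: eq_bigr => k _; rewrite -yE sa.
(* As [M <= N], the filter can be padded by zeros to a full period, so no column is met twice. *)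
rewrite (big_ord_widen N (fun k => ((f k)%:C)%C * psi (bits (y k * 2 ^ a)))) //.
rewrite big_mkcond /=.
transitivity (\sum_(k < N) ((f k)%:C)%C * psi (bits (y k * 2 ^ a))).
  apply: eq_bigr => k _; case: ltnP => // /fout ->.
  by rewrite rmorph0 mul0r.
pose put (k : 'I_N) : 'I_(2 ^ n) := Ordinal (yN k).
have get_lt (j : nat) : ((j %% N + N - t.*2) %% N < N)%N by rewrite ltn_mod.
(* Subtracting [t.*2] modulo [N] inverts [y] on the block and is the filter index occurring in
   [wkernel]. *)
pose get (j : 'I_(2 ^ n)) : 'I_N := Ordinal (get_lt j).
transitivity (\sum_(j : 'I_(2 ^ n) | (x %/ N == j %/ N)%N)
    ((f (get j))%:C)%C * psi (bits (j * 2 ^ a))).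
  rewrite [RHS](reindex_onto put get) /=; last first.
    move=> j /eqP e; apply: val_inj; rewrite /= /y e modnDmr subnKC; last first.
      by apply: leq_trans (ltnW tN) (leq_addl _ _).
    by rewrite modnDr modn_mod -divn_eq.
  have getK k : get (put k) = k.
    by apply: val_inj; rewrite /= ymod modn_unshift.
  apply: eq_big => [k|k _]; last by rewrite ymod modn_unshift.
  by rewrite ydiv getK !eqxx.
rewrite [LHS]big_mkcond; apply: eq_bigr => j _; rewrite !mxE -/m -/N.
case: ifP => _; last by rewrite mul0r.
congr (_ * _); rewrite /wkernel.
have -> : N./2 = half by rewrite NE doubleK.
rewrite xN /f; case: (b); last by rewrite mul0n add0n th' mul2n.
by rewrite mul1n ltnNge leq_addr /= addKn mul2n.
Qed.

(** Summing [60 * (n - l)] over the levels gives 60 dn - 30 d(d - 1). The bound is doubled and its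
    square moved to the left, which avoids halves and truncated subtraction. *)
Lemma packet_circuit L n d (h : nat -> R) :
  let M := L.+1.*2 in let a := (up_log 2 M + 1)%N in
  wavelet_filter M h -> (0 < d)%N -> (d <= n)%N -> (M <= 2 ^ (n - d + 1))%N ->
  exists gs : seq (gate R), [/\ all (gate_ok (ltn^~ (n + a)%N)) gs,
    (2 * size gs + 60 * d ^ 2 <= 60 * (2 * (d * n) + d) + 48 * (d * (up_log 2 M * M)))%N &
    forall psi, clean (iota 0 a) psi -> clean (iota 0 a) (sems gs psi) /\
      \col_(x < 2 ^ n) sems gs psi (bits (x * 2 ^ a)) =
      packet_qwt M n d h *m \col_(x < 2 ^ n) psi (bits (x * 2 ^ a))].
Proof.
move=> M a wf d0 dn MN.
suff gen j : (j <= d)%N -> exists gs : seq (gate R), [/\ all (gate_ok (ltn^~ (n + a)%N)) gs,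
    (2 * size gs + 60 * j ^ 2 <= 60 * (2 * (j * n) + j) + 48 * (j * (up_log 2 M * M)))%N &
    forall psi, clean (iota 0 a) psi -> clean (iota 0 a) (sems gs psi) /\
      \col_(x < 2 ^ n) sems gs psi (bits (x * 2 ^ a)) =
      packet_qwt M n j h *m \col_(x < 2 ^ n) psi (bits (x * 2 ^ a))] by exact: gen.
elim: j => [|j IH] jd.
  by exists [::]; split=> // psi cl; split=> //; rewrite /packet_qwt /= mul1mx.
have [gs [ok sz gsE]] := IH (ltnW jd).
have jn : (j < n)%N by apply: leq_trans dn.
have MNj : (M <= 2 ^ (n - j))%N.
  by apply: leq_trans MN _; rewrite leq_exp2l //; move: jd dn; clear; lia.
have [gs' [ok' sz' gsE']] := level_circuit wf jn MNj.
exists (gs ++ gs'); split.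
- by rewrite all_cat ok ok'.
- rewrite size_cat; move: sz sz' jn; rewrite -/M -!mulnn; move: (up_log 2 M * M)%N; clear.
  by move: (size gs) (size gs') => g g' u; nia.
move=> psi cl; have [cl1 e1] := gsE psi cl; have [cl2 e2] := gsE' _ cl1.
rewrite sems_cat; split=> //; rewrite e2 e1 mulmxA; congr (_ *m _).
by rewrite /packet_qwt -[in RHS](addn1 j) iotaD foldl_cat.
Qed.

(** Yields M log M <= 2 M^(3/2). With u the logarithm rounded up, 2^(u-1) < M, so u^2 <= 4 * 2^(u-1)
    is enough; this goes by induction from u = 4, smaller values being computed. *)
Lemma up_log_sqr M : (0 < M)%N -> (up_log 2 M ^ 2 <= 4 * M)%N.
Proof.
move=> M0; have [M1|M1] := leqP M 1.
  by have -> : up_log 2 M = 0%N by apply/eqP; rewrite up_log_eq0 M1 orbT.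
have lt := up_log_gtn (isT : (1 < 2)%N) M1.
apply: leq_trans (_ : 4 * 2 ^ (up_log 2 M).-1 <= _)%N; last by rewrite leq_mul2l ltnW.
have : (0 < up_log 2 M)%N by rewrite up_log_gt0.
case: (up_log 2 M) => // u _; rewrite -pred_Sn {lt}.
have gen v : ((v + 3).+1 ^ 2 <= 4 * 2 ^ (v + 3))%N.
  elim: v => // v IH; rewrite [(2 ^ (v.+1 + 3))%N]expnS mulnCA.
  by apply: leq_trans (leq_mul (leqnn 2) IH); rewrite -!mulnn; nia.
by case: u => [|[|[|u]]] //; have := gen u; rewrite addn3.
Qed.

(** The hypothesis reads g <= 60 (dn - d^2/2) + 30 d + 24 d u M. Since u M <= 2 M^(3/2) and 1 <=
    M^(3/2), the last two terms are at most 78 d M^(3/2); 100 is a round bound for both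
    coefficients, dn - d^2/2 being nonnegative. *)
Lemma gate_count L n d g (M := L.+1.*2) : (0 < d)%N -> (d <= n)%N ->
  (2 * g + 60 * d ^ 2 <= 60 * (2 * (d * n) + d) + 48 * (d * (up_log 2 M * M)))%N ->
  (g%:R : R) <=
    100%:R * ((d * n)%:R - (d ^ 2)%:R / 2 + d%:R * Num.sqrt ((M ^ 3)%:R)).
Proof.
move=> d0 dn; set S := Num.sqrt _; set u := up_log 2 M.
rewrite -!mulnn -(ler_nat R) (natrD _ (2 * g)) (natrM _ 2 g) (natrM _ 60 (d * d)).
rewrite (natrD _ (60 * _)) (natrM _ 60 (2 * (d * n) + d)) (natrD _ (2 * _)) (natrM _ 2 (d * n)).
rewrite (natrM _ 48) (natrM _ d (u * M)) (natrM _ d d) (natrM _ d n) (natrM _ u M).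
have uMS : (u * M)%:R <= 2 * S.
  have -> : 2 * S = Num.sqrt ((4 * M ^ 3)%:R) :> R.
    have e4 : 4%:R = 2 ^+ 2 :> R by ring.
    by rewrite natrM sqrtrM ?ler0n // e4 sqrtr_sqr ger0_norm.
  rewrite -[X in X <= _]ger0_norm ?ler0n // -sqrtr_sqr ler_wsqrtr // -natrX ler_nat.
  rewrite expnMn -[3%N]/(1 + 2)%N expnD expn1 mulnA leq_mul2r; apply/orP; right.
  exact: up_log_sqr.
have S1 : 1 <= S.
  rewrite -[1]sqrtr1 ler_wsqrtr // (ler_nat _ 1) expn_gt0; exact/orP/or_introl.
have dn' : (d%:R : R) * d%:R <= d%:R * n%:R by rewrite ler_wpM2l ?ler0n // ler_nat.
have dd : 0 < (d%:R : R) by rewrite ltr0n.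
rewrite (natrM _ u M) in uMS.
have h1 : d%:R * (u%:R * M%:R) <= d%:R * (2 * S) by apply: ler_wpM2l => //; apply: ltW.
have h2 : d%:R * 1 <= d%:R * S by apply: ler_wpM2l => //; apply: ltW.
move: (d%:R * (u%:R * M%:R)) h1 => X h1 h; move: h1 h2 h.
rewrite (_ : d%:R * (2 * S) = 2 * (d%:R * S)); last by ring.
have dd0 : 0 <= (d%:R : R) * d%:R by rewrite mulr_ge0 // ltW.
by move: (d%:R * S) (d%:R * d%:R) (d%:R * n%:R) dn' dd0 => Y Z T; rewrite mulr1; lra.
Qed.

End Level.

Local Open Scope ring_scope.

Theorem theorem3 :
  exists K : nat,
  forall (R : realType) (M n d : nat) (h : nat -> R),
    ~~ odd M -> (0 < M)%N -> wavelet_filter M h ->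
    (0 < d)%N -> (d <= n)%N -> (M <= 2 ^ (n - d + 1))%N ->
    exists c : seq 'M[R[i]]_(2 ^ (n + (up_log 2 M + 1))),
      all_gates _ c /\
      implements_with_ancillas n (up_log 2 M + 1) c (packet_qwt M n d h) /\
      ((size c)%:R : R) <=
        K%:R * ((d * n)%:R - (d ^ 2)%:R / 2 + d%:R * Num.sqrt ((M ^ 3)%:R)).
Proof.
exists 100%N => R M n d h oddM M0 wf d0 dn MN.
have [L ML] : exists L, M = L.+1.*2.
  by exists (M./2.-1); rewrite prednK ?even_halfK //; move: oddM M0; case: (M) => [|[]].
subst M; have [gs [ok sz gsE]] := packet_circuit wf d0 dn MN.
set a := (up_log 2 _ + 1)%N in ok gsE *.
exists (circuit_of (n + a) gs); split; first exact: circuit_of_gates.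
split; last by rewrite size_map; apply: gate_count.
move=> x y z xn yn za; pose X := (x * 2 ^ a)%N; pose Y := (y * 2 ^ a + z)%N.
have a0 : (0 < 2 ^ a)%N by rewrite expn_gt0.
have Xk : (X < 2 ^ (n + a))%N by rewrite expnD ltn_pmul2r.
have Yk : (Y < 2 ^ (n + a))%N.
  by rewrite expnD -ltn_divLR // divnMDl // divn_small // addn0.
(* The image of the indicator of the basis state [X] is the column of the circuit matrix at [X]. *)
pose psi s : R[i] := (numval (iota 0 (n + a)) s == X)%:R.
have psiE w : (w < 2 ^ (n + a))%N -> psi (bits w) = (w == X)%:R.
  by move=> wk; rewrite /psi numval_bits expn0 divn1 modn_small.
have cl : clean (iota 0 a) psi.
  move=> s /hasP[q]; rewrite mem_iota add0n => /andP[_ qa] sq; rewrite /psi.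
  case: eqP => // e; have := bit_numval 0 (n + a) s q.
  by rewrite e bit_shift leqNgt qa add0n sq andbT ltn_addl.
have [cl' colE] := gsE psi cl.
have -> : mxnat (circuit_mx (circuit_of (n + a) gs)) Y X = sems gs psi (bits Y).
  have /matrixP/(_ (Ordinal Yk) 0) := circuit_of_vec psi ok.
  rewrite !mxE /= => <-; rewrite (bigD1 (Ordinal Xk)) //= mxE psiE // eqxx mulr1.
  rewrite big1 => [|j /negbTE ne]; first by rewrite addr0 /mxnat !insubT.
  by rewrite mxE psiE // -[X]/(val (Ordinal Xk)) val_eqE ne mulr0.
case: eqP => [z0|nz]; last first.
  apply: cl'; apply: contraPT nz => /numval_zero; rewrite numval_bits expn0 divn1 modnMDl.
  by rewrite modn_small // => ->.
move/matrixP: colE => /(_ (Ordinal yn) 0); rewrite !mxE /= {1}/Y z0 addn0 => ->.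
rewrite (bigD1 (Ordinal xn)) //= mxE psiE // eqxx mulr1 big1 => [|j ne].
  by rewrite addr0 /mxnat !insubT.
rewrite mxE psiE; last by rewrite expnD ltn_pmul2r.
by rewrite eqn_pmul2r // -[x]/(val (Ordinal xn)) val_eqE (negbTE ne) mulr0.
Qed.
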